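(* Let $(I,\rho,m)$ be a homogeneous space with $I$ compact, $m(I)=1$ and $m(\{x\})=0$ for every $x\in I$, let $\beta$ be the associated Macías–Segovia quasi-metric, and let $\gamma>0$ be an admissible exponent. Let $\mathcal{P}$ be a $\beta$-adapted good grid on $I$ with exponent $\eta$. Suppose that $p\in[1,\infty)$, $q\in[1,\infty]$, $0<s<1/p$, $\eta>sp$ and $0<s<\gamma$. Then the Han–Lu–Yang Besov space and the Besov space induced by the grid coincide: $$B_{HLY}(s,p,q)=\mathcal{B}^s_{p,q}(\mathcal{P}).$$
   Context: A quasi-metric on $I$ is a function $\rho:I\times I\to[0,\infty)$ with $\rho(x,x)=0$, $\rho(x,y)>0$ if $x\ne y$, $\rho(x,y)=\rho(y,x)$, and $\rho(x,z)\le C(\rho(x,y)+\rho(y,z))$ for some $C\ge1$. $B_\rho(x,r)=\{y:\rho(x,y)<r\}$; $\rho(x,A)=\inf_{y\in A}\rho(x,y)$. A homogeneous space $(I,\rho,m)$ is a topological space $I$ with a quasi-metric $\rho$ whose balls are open (and define the topology) and a Borel measure $m$ that is doubling: there is $C>0$ with $0<m(B_\rho(x,r))<C\,m(B_\rho(x,r/2))<\infty$ for all $x\in I$, $r>0$. Write $|S|=m(S)$. Define $\beta(x,y)=\inf\{m(B): B\text{ is a }\rho\text{-ball containing }x\text{ and }y\}$. Then $\beta$ is a quasi-metric and $\frac1Cr\le m(B_\beta(x,r))\le Cr$ for all $x$ and all $0<r\le r_0$, for some $C,r_0>0$. Let $C_\beta\ge 1$ be a constant with $\beta(x,z)\le C_\beta(\beta(x,y)+\beta(y,z))$.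 The exponent $\gamma>0$ is admissible if $d_\gamma(x,y)=\inf\{\sum_{i=1}^{n-1}\beta(x_i,x_{i+1})^\gamma:\ n\ge 2,\ x_i\in I,\ x_1=x,\ x_n=y\}$ is a metric on $I$ and $\frac1Cd_\gamma\le\beta^\gamma\le C d_\gamma$ for some $C\ge 1$ (this holds for all small $\gamma$). A good grid on $(I,\mathbb{A},m)$ ($\mathbb{A}$ = Borel sets) is a sequence $\mathcal{P}=(\mathcal{P}^k)_{k\ge0}$ of finite families of measurable sets with positive measure such that: (i) every $\mathcal{P}^k$ is a partition of $I$ up to sets of zero measure, and every element of $\mathcal{P}^{k+1}$ is contained in an element of $\mathcal{P}^k$; (ii) $\bigcup_k\mathcal{P}^k$ generates $\mathbb{A}$; (iii) there are $\lambda,\hat\lambda\in(0,1)$ with $\hat\lambda\le|Q|/|P|\le\lambda$ whenever $Q\subset P$, $Q\in\mathcal{P}^{k+1}$, $P\in\mathcal{P}^k$. It is $\beta$-adapted with exponent $\eta$ if there are constants $\eta,c_1,c_2,c_3,c_4>0$, $\lambda_*\in(0,1)$ such that for every $k\ge1$ and $Q\in\mathcal{P}^k$ there is $z_Q\in Q$ with $B_\beta(z_Q,c_1\lambda_*^k)\subset Q$, $\operatorname{diam}_\beta Q\le c_2\lambda_*^k$, and $m\{x\in Q:\beta(x,I\setminus Q)\le c_3t\lambda_*^k\}\le c_4t^\eta m(Q)$ for all $t>0$. These points $z_Q$ and constants are fixed; for $Q\in\mathcal{P}^0$ fix any $z_Q\in Q$. Grid Besov space: let $e_Q=|Q|^{s-1/p}1_Q$.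 $\mathcal{B}^s_{p,q}(\mathcal{P})$ is the space of $f\in L^p$ that can be written as $f=\sum_{k\ge0}\sum_{Q\in\mathcal{P}^k}s_Qe_Q$ with $s_Q\in\mathbb{C}$, the series over $k$ converging absolutely in $L^p$ (i.e. $\sum_k|\sum_{Q\in\mathcal{P}^k}s_Qe_Q|_{L^p}<\infty$), and $\big(\sum_k(\sum_{Q\in\mathcal{P}^k}|s_Q|^p)^{q/p}\big)^{1/q}<\infty$ (supremum over $k$ if $q=\infty$). Han–Lu–Yang Besov space (in its atomic description): a $\gamma$-block associated to $Q\in\mathcal{P}^k$ is a function $a_Q:I\to\mathbb{C}$ with $\operatorname{supp}a_Q\subset B_\beta(z_Q,3C_\beta c_2\lambda_*^k)$, $|a_Q|_\infty\le|Q|^{s-1/p}$, and $|a_Q(x)-a_Q(y)|\le|Q|^{s-1/p-\gamma}\beta(x,y)^\gamma$ for all $x,y$. $B_{HLY}(s,p,q)$ is the set of $f\in L^p$ that can be written as $f=\sum_k\sum_{Q\in\mathcal{P}^k}c_Qa_Q$, where $c_Q\in\mathbb{C}$, each $a_Q$ is a $\gamma$-block associated to $Q$, $\sum_k|\sum_{Q\in\mathcal{P}^k}c_Qa_Q|_{L^p}<\infty$, and $\big(\sum_k(\sum_{Q\in\mathcal{P}^k}|c_Q|^p)^{q/p}\big)^{1/q}<\infty$. *)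

(* Defs.v *)
From mathcomp Require Import all_boot all_order all_algebra.
From mathcomp Require Import complex.
From mathcomp Require Import all_classical all_reals all_analysis.

Set Implicit Arguments.
Unset Strict Implicit.
Unset Printing Implicit Defensive.

Import Order.TTheory GRing.Theory Num.Theory.
Import numFieldNormedType.Exports.

Local Open Scope classical_set_scope.
Local Open Scope ring_scope.

(* [ptopologicalType] rather than [topologicalType] only because
   [measurableType] inherits from [pointedType]. *)
Notation borelType I := (g_sigma_algebraType (@open I)).

Definition cmod {R : realType} (z : R[i]) : R := ComplexField.Normc.normc z.

Section QuasiMetric.
Context {R : realType} {T : Type}.
Implicit Types (d : T -> T -> R) (x : T) (A : set T) (r : R).

Definition quasi_triangle (C : R) d : Prop :=
  forall x y z, d x z <= C * (d x y + d y z).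

Definition quasi_metric d : Prop :=
  [/\ forall x y, 0 <= d x y,
      forall x, d x x = 0,
      forall x y, x <> y -> 0 < d x y,
      forall x y, d x y = d y x &
      exists2 C, 1 <= C & quasi_triangle C d].

Definition is_metric d : Prop :=
  [/\ forall x y, 0 <= d x y,
      forall x y, d x y = 0 <-> x = y,
      forall x y, d x y = d y x &
      forall x y z, d x z <= d x y + d y z].

Definition qball d x r : set T := [set y | d x y < r].

(* Extended-real valued, so that the distance to the empty set is +oo. *)
Definition qdist d x A : \bar R := ereal_inf [set (d x y)%:E | y in A].

Definition qdiam d A : \bar R :=
  ereal_sup [set w | exists x y, [/\ A x, A y & w = (d x y)%:E]].

End QuasiMetric.

Section HomogeneousSpace.
Context {R : realType} {I : ptopologicalType}.
Variable m : {measure set (borelType I) -> \bar R}.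
Implicit Types (rho beta : I -> I -> R).

Definition doubling rho : Prop :=
  exists2 C : R, 0 < C & forall (x : I) (r : R), 0 < r ->
    [/\ (0 < m (qball rho x r))%E,
        (m (qball rho x r) < C%:E * m (qball rho x (r / 2)))%E &
        (C%:E * m (qball rho x (r / 2)) < +oo)%E].

Definition homogeneous_space rho : Prop :=
  [/\ quasi_metric rho,
      forall (x : I) (r : R), 0 < r -> open (qball rho x r),
      forall x (U : set I),
        nbhs x U <-> exists2 r : R, 0 < r & qball rho x r `<=` U &
      doubling rho].

(* The Macias-Segovia quasi-metric. *)
Definition ms_beta rho (x y : I) : R :=
  inf [set v | exists (z : I) (r : R), [/\ 0 < r, qball rho z r x, qball rho z r y &
                              v = fine (m (qball rho z r))]].

End HomogeneousSpace.

Definition chain_dist {R : realType} {T : Type} (beta : T -> T -> R)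
    (gamma : R) (x y : T) : R :=
  inf [set v | exists n (c : nat -> T),
    [/\ (2 <= n)%N, c 1%N = x, c n = y &
        v = \sum_(1 <= i < n) beta (c i) (c i.+1) `^ gamma]].

Definition admissible {R : realType} {T : Type} (beta : T -> T -> R)
    (gamma : R) : Prop :=
  [/\ 0 < gamma,
      is_metric (chain_dist beta gamma) &
      exists2 C : R, 1 <= C & forall x y,
        C^-1 * chain_dist beta gamma x y <= beta x y `^ gamma
          <= C * chain_dist beta gamma x y].

(* The value at [q = -oo] is irrelevant. *)
Definition lqlp_norm {R : realType} {T : Type} (p : R) (q : \bar R)
    (Pg : nat -> set (set T)) (c : nat -> set T -> R[i]) : \bar R :=
  let A k := \sum_(Q \in Pg k) cmod (c k Q) `^ p in
  match q with
  | q%:E => ((\sum_(0 <= k <oo) (A k `^ (q / p))%:E) `^ q^-1)%E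
  | +oo%E => ereal_sup (range (fun k => (A k `^ p^-1)%:E))
  | -oo%E => +oo%E
  end.

Section Grids.
Context {d : measure_display} {T : measurableType d} {R : realType}.
Variable m : {measure set T -> \bar R}.
Implicit Types (Pg : nat -> set (set T)) (p q s : R).

Definition vol (A : set T) : R := fine (m A).

Definition ae_partition (F : set (set T)) : Prop :=
  m (~` \bigcup_(Q in F) Q) = 0%E /\
  forall Q Q', F Q -> F Q' -> Q <> Q' -> m (Q `&` Q') = 0%E.

Definition good_grid Pg : Prop :=
  [/\ forall k, finite_set (Pg k),
      forall k Q, Pg k Q -> measurable Q /\ (0 < m Q)%E,
      (forall k, ae_partition (Pg k)) /\
      (forall k Q, Pg k.+1 Q -> exists2 P, Pg k P & Q `<=` P),
      measurable = <<s \bigcup_k Pg k >> &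
      exists lam lam' : R, [/\ 0 < lam < 1, 0 < lam' < 1 &
        forall k P Q, Pg k P -> Pg k.+1 Q -> Q `<=` P ->
          lam' <= vol Q / vol P <= lam]].

Definition grid_adapted (beta : T -> T -> R) (eta c1 c2 c3 c4 lam : R)
    (z : nat -> set T -> T) Pg : Prop :=
  [/\ [/\ 0 < eta, 0 < c1, 0 < c2, 0 < c3 & 0 < c4],
      0 < lam < 1,
      forall k Q, Pg k Q -> Q (z k Q) &
      forall k Q, (1 <= k)%N -> Pg k Q ->
        [/\ qball beta (z k Q) (c1 * lam ^+ k) `<=` Q,
            (qdiam beta Q <= (c2 * lam ^+ k)%:E)%E &
            forall t : R, 0 < t ->
              (m (Q `&` [set x | (qdist beta x (~` Q)
                                   <= (c3 * t * lam ^+ k)%:E)%E])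
               <= (c4 * t `^ eta)%:E * m Q)%E]].

Definition Lp_cnorm p (f : T -> R[i]) : \bar R :=
  Lnorm m p%:E (fun x => (cmod (f x))%:E).

Definition LpC p (f : T -> R[i]) : Prop :=
  [/\ measurable_fun [set: T] (fun x => complex.Re (f x)),
      measurable_fun [set: T] (fun x => complex.Im (f x)) &
      (Lp_cnorm p f < +oo)%E].

Definition Lp_abs_sum p (u : nat -> T -> R[i]) (f : T -> R[i]) : Prop :=
  [/\ forall k, LpC p (u k),
      (\sum_(0 <= k <oo) Lp_cnorm p (u k) < +oo)%E &
      Lp_cnorm p (fun x => f x - \sum_(k < n) u k x) @[n --> \oo] --> 0%E].

Definition grid_atom s p (Q : set T) (x : T) : R[i] :=
  (vol Q `^ (s - p^-1))%:C%C * \1_Q x.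

(* Both Besov spaces are sets of representatives: they are stable under
   almost-everywhere equality of measurable functions. *)
Definition grid_besov s p (q : \bar R) Pg : set (T -> R[i]) :=
  [set f | LpC p f /\ exists c : nat -> set T -> R[i],
    Lp_abs_sum p (fun k x => \sum_(Q \in Pg k) c k Q * grid_atom s p Q x) f /\
    (lqlp_norm p q Pg c < +oo)%E].

End Grids.

Section HanLuYang.
Context {R : realType} {I : ptopologicalType}.
Variable m : {measure set (borelType I) -> \bar R}.

Definition gamma_block (beta : I -> I -> R) (Cb c2 lam gamma s p : R)
    (z : nat -> set I -> I) (k : nat) (Q : set I) (a : I -> R[i]) : Prop :=
  [/\ closure [set x | a x <> 0]
        `<=` qball beta (z k Q) (3 * Cb * c2 * lam ^+ k),
      forall x, cmod (a x) <= vol m Q `^ (s - p^-1) &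
      forall x y, cmod (a x - a y)
        <= vol m Q `^ (s - p^-1 - gamma) * beta x y `^ gamma].

Definition hly_besov (beta : I -> I -> R) (Cb c2 lam gamma : R)
    (z : nat -> set I -> I) (Pg : nat -> set (set I))
    (s p : R) (q : \bar R) : set (I -> R[i]) :=
  [set f | LpC m p f /\
    exists (c : nat -> set I -> R[i]) (a : nat -> set I -> I -> R[i]),
    [/\ forall k Q, Pg k Q ->
          gamma_block beta Cb c2 lam gamma s p z k Q (a k Q),
        Lp_abs_sum m p
          (fun k x => \sum_(Q \in Pg k) c k Q * a k Q x) f &
        (lqlp_norm p q Pg c < +oo)%E]].

End HanLuYang.

(* Main.v *)
(* Both spaces are compared with the sequence (c_Q) through one discrete scheme.
   Given the level-k terms u_k of a series for f, one builds a new series whose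
   partial sum at level j is determined by one number G_j(Q) per cell Q of level
   j: the sampled value of u_0 + ... + u_j at z_Q when the u_k are sums of blocks,
   and the value of u_0 + ... + u_j on Q, smoothed by a Hoelder partition of unity
   at scale lam^j, when they are grid functions.  The level-j coefficient is then
   at most
     |Q|^(1/p-s) sum_(k <= j) w_kj(Q) sum_(P near Q, level k) |c_P| |P|^(s-1/p),
   where w_kj is lam^((j-k) gamma) in the first case (Hoelder continuity) and the
   indicator that Q lies within O(lam^j) of the boundary of its level-k ancestor
   in the second (the boundary layer condition).  In both cases the p-th powers
   of the weights have mass at most O(tau^(j-k)) |P| inside each level-k cell P,
   with tau = lam^(gamma p) or tau = lam^eta, and tau lam^(-sp) < 1 because
   s < gamma or s p < eta.  Hence the p-th power sums of the new coefficients are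
   bounded by a geometric convolution of the old ones, which preserves
   summability of order q/p. *)
Require Import Defs.
From mathcomp Require Import all_boot all_order all_algebra.
From mathcomp Require Import complex.
From mathcomp Require Import all_classical all_reals all_analysis.
From mathcomp Require Import measurable_realfun ring lra.
Import Order.TTheory GRing.Theory Num.Theory.
Import numFieldNormedType.Exports.
Local Open Scope classical_set_scope.
Local Open Scope ring_scope.

Set Implicit Arguments.
Unset Strict Implicit.

(** * Power sums and geometric convolutions *)

(** Expanding each block in grid atoms, or each atom in blocks, would require rearranging double
    series in Lp. Comparing partial sums avoids this: the old and the new sum up to level j differ
    by at most a level-j atom sum, whose Lp norm is O(lam^(s j)), so both series have the same
    limit. The outer exponent q/p can be smaller than 1, where the l^(q/p) norm has no triangle
    inequality; the inequalities on powers below are therefore proved for every positive exponent at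
    once. They lose a factor close to 1 per level, which the strict inequality tau lam^(-sp) < 1
    absorbs. Sampling is legitimate because blocks are defined at every point. In the other
    direction the cells cover the space only up to a null set whereas a block is Hoelder at every
    point; the positive measure of balls bridges this gap. *)

Section PowerSums.
Context {R : realType}.
Implicit Types (r d x y t : R) (a b : nat -> R).

Lemma lt0r_neq0 x : 0 < x -> x != 0.
Proof. by move=> x0; rewrite gt_eqF. Qed.

Lemma powR1r r : 1 `^ r = 1 :> R.
Proof. by rewrite powR1. Qed.

Lemma le_powR r x y : 0 <= r -> 0 <= x -> x <= y -> x `^ r <= y `^ r.
Proof. by move=> r0 x0 xy; apply: ge0_ler_powR; rewrite ?nnegrE// (le_trans x0). Qed.

Lemma powR_ge1 r x : 0 <= r -> 1 <= x -> 1 <= x `^ r.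
Proof. by move=> r0 x1; rewrite -[leLHS](powR1r r) le_powR. Qed.

Lemma powR_exprC r x n : 0 <= x -> (x ^+ n) `^ r = (x `^ r) ^+ n.
Proof.
by move=> x0; rewrite -(powR_mulrn n x0) -(powR_mulrn n (powR_ge0 x r)) -!powRrM mulrC.
Qed.

(* The factor of [x `^ r] can be chosen arbitrarily close to 1: this replaces the
   inequalities of Minkowski and Young. *)
Lemma powRD_le r d x y : 0 <= r -> 0 < d -> 0 <= x -> 0 <= y ->
  (x + y) `^ r <= (1 + d) `^ r * x `^ r + (1 + d^-1) `^ r * y `^ r.
Proof.
move=> r0 d0 x0 y0; have d0' : 0 < d^-1 by rewrite invr_gt0.
have [yx|xy] := leP y (d * x).
  rewrite -[leLHS]addr0 lerD ?mulr_ge0 ?powR_ge0//.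
  rewrite -powRM//; last lra.
  by apply: le_powR => //; nra.
rewrite -[leLHS]add0r lerD ?mulr_ge0 ?powR_ge0//.
have xy' : x <= d^-1 * y by rewrite mulrC ler_pdivlMr// mulrC ltW.
rewrite -powRM//; last lra.
by apply: le_powR => //; nra.
Qed.

(** Splitting off the last term again and again costs each older term one more factor (1 + d)^r. For
    small [d] this growth in n - k is slower than any given geometric decay of the [E k]. *)
Lemma powR_sum_geometric r d n (E : nat -> R) : 0 < r -> 0 < d ->
  (forall k, 0 <= E k) ->
  (\sum_(k < n) E k) `^ r <= (1 + d^-1) `^ r *
     (\sum_(k < n) ((1 + d) `^ r) ^+ (n - k) * E k `^ r).
Proof.
move=> /[dup] r0' /ltW r0 d0 E0; have d0' : 0 < d^-1 by rewrite invr_gt0.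
set mu := (1 + d) `^ r; set K := (1 + d^-1) `^ r.
have mu1 : 1 <= mu by rewrite /mu powR_ge1; lra.
have K1 : 1 <= K by rewrite /K powR_ge1; lra.
have mu0 : 0 <= mu by lra.
elim: n => [|n IHn]; first by rewrite !big_ord0 powR0 ?mulr0// gt_eqF.
rewrite !big_ord_recr /= subSnn expr1.
apply: (le_trans (@powRD_le r d _ _ r0 d0 _ _)) => //; first exact: sumr_ge0.
rewrite mulrDr lerD//; last by rewrite ler_wpM2l ?ler_peMl ?powR_ge0.
apply: (le_trans (ler_wpM2l mu0 IHn)).
rewrite mulrCA ler_wpM2l//; first lra.
rewrite mulr_sumr ler_sum// => k _.
by rewrite subSn ?exprS ?mulrA// ltnW.
Qed.

(** Each selected term is at most the r-th root of the sum [X] of r-th powers, and at most [N] terms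
    are selected. Unlike convexity, this also works for r below 1. *)
Lemma powR_sum_overlap (I : Type) (s : seq I) (P : pred I) (N : nat) r (x : I -> R) :
  0 < r -> (forall i, 0 <= x i) -> (count P s <= N)%N ->
  (\sum_(i <- s | P i) x i) `^ r <= N%:R `^ r * \sum_(i <- s | P i) x i `^ r.
Proof.
move=> r0 x0 sN; set X := \sum_(i <- s | P i) x i `^ r.
have X0 : 0 <= X by apply: sumr_ge0 => i _; rewrite powR_ge0.
have rN0 : r != 0 by rewrite gt_eqF.
have le_sum : \sum_(i <- s | P i) x i <= N%:R * X `^ r^-1.
  apply: (@le_trans _ _ (\sum_(i <- s | P i) X `^ r^-1)); last first.
    rewrite big_const_seq iter_addr_0 -[leLHS]mulr_natl ler_wpM2r ?powR_ge0//.
    by rewrite ler_nat.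
  elim: s @X X0 {sN} => [|i s IHs] /=; first by rewrite !big_nil.
  rewrite !big_cons; case: ifP => Pi X0; last exact: IHs.
  have X1 : 0 <= \sum_(j <- s | P j) x j `^ r.
    by apply: sumr_ge0 => j _; rewrite powR_ge0.
  have ri : 0 <= r^-1 by rewrite invr_ge0 ltW.
  apply: lerD.
    rewrite -{1}[x i]powRr1// -{1}(mulfV rN0) powRrM.
    by rewrite le_powR ?powR_ge0// lerDl.
  apply: (le_trans (IHs X1)); apply: ler_sum => j _.
  by rewrite le_powR// lerDr powR_ge0.
apply: (@le_trans _ _ ((N%:R * X `^ r^-1) `^ r)).
  by apply: le_powR => //; [exact: ltW|exact: sumr_ge0].
by rewrite powRM ?powR_ge0// -powRrM mulVf// powRr1.
Qed.

(** The convolution satisfies [B j.+1 = t * B j + a j.+1], so its r-th powers obey a linear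
    recursion of ratio [ka], which is below 1 for small [d]; summing over j, the old powers are
    absorbed on the left. *)
Lemma young_geometric r t : 0 < r -> 0 < t < 1 -> exists2 K, 0 < K &
  forall a, (forall k, 0 <= a k) -> forall n,
  \sum_(j < n) (\sum_(k < j.+1) t ^+ (j - k) * a k) `^ r
    <= K * \sum_(j < n) a j `^ r.
Proof.
move=> r0 /andP[t0 t1].
(* Then (1 + d) t = t (3 - t) / 2, which is below 1 for t in (0, 1). *)
pose d := (1 - t) / 2; have d0 : 0 < d by rewrite /d; lra.
pose ka := (1 + d) `^ r * t `^ r; pose K := (1 + d^-1) `^ r.
have d0' : 0 < d^-1 by rewrite invr_gt0.
have K1 : 1 <= K by rewrite /K powR_ge1; lra.
have ka0 : 0 <= ka by rewrite mulr_ge0 ?powR_ge0.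
have ka1 : ka < 1.
  rewrite /ka -powRM; [|lra|lra]; rewrite -[ltRHS](powR1r r) gt0_ltr_powR//.
  - by rewrite nnegrE mulr_ge0//; lra.
  - by rewrite nnegrE.
  - by rewrite /d; nra.
exists (K / (1 - ka)); first by rewrite divr_gt0; lra.
move=> a a0; pose B j := \sum_(k < j.+1) t ^+ (j - k) * a k.
have B0 j : 0 <= B j by apply: sumr_ge0 => k _; rewrite mulr_ge0 ?exprn_ge0 ?a0// ltW.
have BS j : B j.+1 = t * B j + a j.+1.
  rewrite /B big_ord_recr /= subnn expr0 mul1r mulr_sumr; congr (_ + _).
  by apply: eq_bigr => k _; rewrite subSn -1?ltnS// exprS mulrA.
have key n : \sum_(j < n.+1) B j `^ r
    <= ka * (\sum_(j < n) B j `^ r) + K * \sum_(j < n.+1) a j `^ r.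
  elim: n => [|n IHn].
    rewrite !big_ord_recr !big_ord0 /= /B big_ord_recr big_ord0 /= expr0.
    by rewrite !add0r mul1r mulr0 add0r ler_peMl ?powR_ge0.
  rewrite big_ord_recr /= [X in _ <= ka * X + _]big_ord_recr.
  rewrite [X in _ <= _ + K * X]big_ord_recr /= !mulrDr addrACA lerD//.
  rewrite BS /ka -mulrA -powRM//; [|exact: ltW].
  by apply: powRD_le => //; rewrite ?mulr_ge0// ltW.
move=> [|n]; first by rewrite !big_ord0 mulr0.
rewrite mulrAC ler_pdivlMr; last by lra.
have := key n; rewrite -/(B _).
have : ka * (\sum_(j < n) B j `^ r) <= ka * (\sum_(j < n.+1) B j `^ r).
  by rewrite ler_wpM2l// big_ord_recr /= lerDl powR_ge0.
rewrite /B; lra.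
Qed.

(** M / (1 - t) is the fixed point of x |-> t x + M, the worst case of the recursion of these sums.
    It serves q = +oo, and it bounds the new level sums uniformly when convergence in Lp is
    checked. *)
Lemma geometric_convolution_le t M a j : 0 < t < 1 -> (forall k, 0 <= a k <= M) ->
  \sum_(k < j.+1) t ^+ (j - k) * a k <= M / (1 - t).
Proof.
move=> /andP[t0 t1] aM; rewrite ler_pdivlMr; last lra.
elim: j => [|j IHj].
  rewrite big_ord_recr big_ord0 /= expr0 add0r mul1r.
  by have /andP[] := aM 0%N; nra.
rewrite big_ord_recr /= subnn expr0 mul1r.
under eq_bigr => k _ do rewrite subSn -1?ltnS// exprS -mulrA.
rewrite -mulr_sumr; set S := \sum_(_ < _) _ in IHj *.
by have /andP[] := aM j.+1; nra.
Qed.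

End PowerSums.

(** * Level sums and the mixed sequence norm *)

Section SeriesTransfer.
Context {R : realType} {T : Type}.
Implicit Types (p K t M : R) (q : \bar R) (Pg : nat -> set (set T))
  (c : nat -> set T -> R[i]).

Lemma nneseries_lty (a : nat -> R) M : (forall k, 0 <= a k) ->
  (forall n, \sum_(k < n) a k <= M) -> (\sum_(0 <= k <oo) (a k)%:E < +oo)%E.
Proof.
move=> a0 aM; apply: (@le_lt_trans _ _ M%:E); last exact: ltry.
apply: lime_le; first by apply: is_cvg_nneseries => k _ _; rewrite lee_fin.
by apply: nearW => n; rewrite big_mkord sumEFin lee_fin.
Qed.

Lemma nneseries_bounded (a : nat -> R) : (forall k, 0 <= a k) ->
  (\sum_(0 <= k <oo) (a k)%:E < +oo)%E -> exists M, forall n, \sum_(k < n) a k <= M.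
Proof.
move=> a0 afin; exists (fine (\sum_(0 <= k <oo) (a k)%:E)%E) => n.
rewrite -lee_fin fineK; last first.
  by rewrite ge0_fin_numE// nneseries_ge0// => k _ _; rewrite lee_fin.
rewrite -sumEFin -(big_mkord xpredT (fun k => (a k)%:E)).
by apply: nneseries_lim_ge => k _ _; rewrite lee_fin.
Qed.

Local Notation A p Pg c k := ( \sum_(Q \in Pg k) cmod (c k Q) `^ p).

Lemma lqlp_sum_ge0 p Pg c k : 0 <= (\sum_(Q \in Pg k) cmod (c k Q) `^ p : R).
Proof. by apply: fsumr_ge0 => Q _; exact: powR_ge0. Qed.

Lemma le_powR_inv p (x y : R) : 0 < p -> 0 <= x -> x `^ p^-1 <= y -> x <= y `^ p.
Proof.
move=> p0 x0 xy; rewrite -[x]powRr1// -(mulVf (lt0r_neq0 p0)) powRrM.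
by rewrite le_powR ?powR_ge0// ltW.
Qed.

Lemma lqlp_norm_ltyP p (r : R) Pg c : 0 < p -> 0 < r ->
  (lqlp_norm p r%:E Pg c < +oo)%E <->
  exists M, forall n, \sum_(k < n) (A p Pg c k) `^ (r / p) <= M.
Proof.
move=> p0 r0; rewrite /lqlp_norm; split=> [|[M AM]].
  move=> /lty_poweRy-/(_ (invr_neq0 (lt0r_neq0 r0))).
  by move=> /nneseries_bounded; apply => k; exact: powR_ge0.
by apply: poweR_lty; apply: nneseries_lty AM => k; exact: powR_ge0.
Qed.

Lemma lqlp_norm_supP p Pg c : 0 < p ->
  (lqlp_norm p +oo%E Pg c < +oo)%E <->
  exists2 M, 0 <= M & forall n, A p Pg c n <= M.
Proof.
move=> p0; rewrite /lqlp_norm; split=> [|[M M0 AM]].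
  set S := ereal_sup _ => Sfin.
  have S0 k : ((A p Pg c k `^ p^-1)%:E <= S)%E by apply: ereal_sup_ubound; exists k.
  have S1 : S \is a fin_num.
    by rewrite ge0_fin_numE// (le_trans _ (S0 0%N))// lee_fin powR_ge0.
  exists (fine S `^ p) => [|k]; first exact: powR_ge0.
  by apply: le_powR_inv => //; [exact: lqlp_sum_ge0|rewrite -lee_fin fineK].
apply: (@le_lt_trans _ _ (M `^ p^-1)%:E); last exact: ltry.
apply: ge_ereal_sup => _ [k _ <-]; rewrite lee_fin le_powR//.
  by rewrite invr_ge0 ltW.
exact: lqlp_sum_ge0.
Qed.

(** Convergence in Lp uses only this consequence of the mixed norm, one bound common to all
    levels. *)
Lemma lqlp_norm_bounded p q Pg c : 0 < p -> (1 <= q)%E ->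
  (lqlp_norm p q Pg c < +oo)%E ->
  exists2 M, 0 <= M & forall k, A p Pg c k <= M.
Proof.
move=> p0; case: q => [r| |]; last by rewrite leeNy_eq.
  rewrite lee_fin => r1 /(lqlp_norm_ltyP _ _ p0)[|M AM]; first lra.
  have r0 : 0 < r by lra.
  exists (M `^ (p / r)) => [|k]; first exact: powR_ge0.
  apply: le_powR_inv; rewrite ?divr_gt0 ?invf_div//; first exact: lqlp_sum_ge0.
  apply: (le_trans _ (AM k.+1)).
  by rewrite big_ord_recr /= lerDr sumr_ge0// => i _; exact: powR_ge0.
by move=> _ /(lqlp_norm_supP _ _ p0).
Qed.

Lemma lqlp_norm_transfer p q Pg c c' K t : 0 < p -> (1 <= q)%E -> 0 < t < 1 -> 0 <= K ->
  (forall j, A p Pg c' j <= K * \sum_(k < j.+1) t ^+ (j - k) * A p Pg c k) ->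
  (lqlp_norm p q Pg c < +oo)%E -> (lqlp_norm p q Pg c' < +oo)%E.
Proof.
move=> p0 q1 t01 K0 AA; have /andP[t0 t1] := t01.
have A0 := lqlp_sum_ge0 p Pg.
have S0 j : 0 <= \sum_(k < j.+1) t ^+ (j - k) * A p Pg c k.
  by apply: sumr_ge0 => k _; rewrite mulr_ge0 ?exprn_ge0// ltW.
case: q q1 => [r| |]; last by rewrite leeNy_eq.
  rewrite lee_fin => r1; have r0 : 0 < r by lra.
  move=> /(lqlp_norm_ltyP _ _ p0 r0)[M AM].
  have rp0 : 0 < r / p by rewrite divr_gt0.
  have [L L0 young] := young_geometric rp0 t01.
  apply/(lqlp_norm_ltyP _ _ p0 r0); exists (K `^ (r / p) * (L * M)) => n.
  apply: (@le_trans _ _ (\sum_(j < n) K `^ (r / p) *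
     (\sum_(k < j.+1) t ^+ (j - k) * A p Pg c k) `^ (r / p))).
    by apply: ler_sum => j _; rewrite -powRM// le_powR// ltW.
  rewrite -mulr_sumr ler_wpM2l ?powR_ge0//.
  apply: (le_trans (young (fun k => A p Pg c k) (A0 c) n)).
  by rewrite ler_wpM2l// ltW.
move=> _ /(lqlp_norm_supP _ _ p0)[M M0 AM].
apply/(lqlp_norm_supP _ _ p0); exists (K * (M / (1 - t))) => [|j].
  by rewrite !mulr_ge0// invr_ge0; lra.
apply: (le_trans (AA j)); rewrite ler_wpM2l//.
by apply: (geometric_convolution_le (a := fun k => A p Pg c k)) => // k; rewrite AM A0.
Qed.

End SeriesTransfer.

(** * Volumes and the Macias-Segovia quasi-metric *)

Section ProbabilityVolume.
Context {d : measure_display} {T : measurableType d} {R : realType}.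
Variable m : {measure set T -> \bar R}.
Hypothesis mT : m [set: T] = 1%E.
Implicit Types A B : set T.

Lemma le_mass1 A : measurable A -> (m A <= 1)%E.
Proof. by move=> mA; rewrite -mT le_measure// inE. Qed.

Lemma volK A : measurable A -> (vol m A)%:E = m A.
Proof.
move=> mA; rewrite fineK// ge0_fin_numE//.
exact: le_lt_trans (le_mass1 mA) (ltry _).
Qed.

Lemma vol_ge0 A : 0 <= vol m A.
Proof. by rewrite fine_ge0. Qed.

Lemma le_vol A B : measurable A -> measurable B -> A `<=` B -> vol m A <= vol m B.
Proof. by move=> mA mB AB; rewrite -lee_fin !volK// le_measure// inE. Qed.

Lemma vol_gt0 A : measurable A -> (0 < m A)%E -> 0 < vol m A.
Proof. by move=> mA; rewrite -volK. Qed.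

Lemma ae_disjoint_vol_sum (s : seq (set T)) (P : pred (set T)) (S : set T) :
  uniq s -> (forall A, A \in s -> P A -> measurable A) ->
  (forall A B, A \in s -> B \in s -> A <> B -> m (A `&` B) = 0%E) ->
  (forall A, A \in s -> P A -> A `<=` S) -> measurable S ->
  \sum_(A <- s | P A) vol m A <= vol m S.
Proof.
move=> us ms s0 sS mS.
(* Containment is weakened to containment up to a null set: once a cell is removed from [S], the
   others may stick out of what remains by their null overlaps with it. *)
have {sS} : forall A, A \in s -> P A -> m (A `\` S) = 0%E.
  by move=> A As PA; rewrite (_ : A `\` S = set0) ?measure0// setD_eq0; exact: sS.
elim: s S us ms s0 mS => [|A s IHs] S /=.
  by move=> *; rewrite big_nil vol_ge0.
move=> /andP[As us] ms s0 mS sS.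
have Amem : A \in A :: s by rewrite inE eqxx.
have smem B : B \in s -> B \in A :: s by rewrite inE => ->; rewrite orbT.
rewrite big_cons; case: ifPn => PA; last first.
  by apply: IHs => // [B Bs|B C Bs Cs|B Bs]; [apply: ms|apply: s0|apply: sS]; exact: smem.
have mA := ms _ Amem PA.
have mSA := measurableD mS mA.
have sumE : vol m S = vol m (S `\` A) + vol m (S `&` A).
  apply: EFin_inj; rewrite EFinD !volK//; last exact: measurableI.
  by rewrite -measureDI.
have volA : vol m A = vol m (S `&` A).
  have {1}-> : vol m A = fine (m (A `\` S) + m (A `&` S)) by rewrite -measureDI.
  by rewrite sS// add0e setIC.
rewrite sumE addrC volA lerD2r; apply: IHs => //.
- by move=> B Bs; apply: ms; exact: smem.
- by move=> B C Bs Cs; apply: s0; exact: smem.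
- move=> B Bs PB; have mB := ms _ (smem _ Bs) PB.
  apply/eqP; rewrite eq_le measure_ge0 andbT.
  apply: (@le_trans _ _ (m ((B `\` S) `|` (B `&` A)))).
    apply: le_measure; rewrite ?inE.
    - exact: measurableD.
    - by apply: measurableU; [exact: measurableD|exact: measurableI].
    - move=> x [Bx Sx]; have [Ax|Ax] := pselect (A x); first by right.
      by left; split=> // Sx'; apply: Sx.
  apply: (le_trans (measureU2 _ _ _)); [exact: measurableD|exact: measurableI|].
  rewrite -[leLHS]/((m (B `\` S) + m (B `&` A))%E) sS//; last exact: smem.
  rewrite add0e s0//; [exact: smem|].
  by move=> BA; rewrite -BA Bs in As.
Qed.

End ProbabilityVolume.

Section MaciasSegovia.
Context {R : realType} {X : ptopologicalType}.
Variables (m : {measure set (borelType X) -> \bar R}) (rho : X -> X -> R).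
Hypothesis rhoH : homogeneous_space m rho.
Hypothesis cI : compact [set: X].
Hypothesis mI : m [set: X] = 1%E.
Hypothesis m1 : forall x : X, m [set x] = 0%E.

Lemma borel_open (U : set X) : open U -> measurable (U : set (borelType X)).
Proof. by move=> oU; apply: sub_sigma_algebra. Qed.

Local Notation beta := (ms_beta m rho).

Let rho_open x r : 0 < r -> open (qball rho x r).
Proof. by case: rhoH => _ h _ _; exact: h. Qed.

Lemma measurable_rball x r : 0 < r -> measurable (qball rho x r : set (borelType X)).
Proof. by move=> r0; apply: borel_open; exact: rho_open. Qed.

(** The balls of integer radii about one point are open and increase to the whole space, so by
    compactness one of them is everything. *)
Lemma rho_bounded : exists2 M, 0 < M & forall x y, rho x y < M.
Proof.
case: (rhoH) => -[rge0 rxx _ rsym [C C1 rtri]] _ _ _.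
pose x0 : X := point.
have [n nI] : exists n, [set: X] `<=` qball rho x0 n%:R.
  have := (compact_near_coveringP _).1 cI nat \oo (fun n y => qball rho x0 n%:R y) _.
  case=> [x _|n _ nI]; last by exists n; exact: (nI n (leqnn n)).
  pose k := (Num.trunc (rho x0 x)).+1.
  have xk : rho x0 x < k%:R by exact: truncnS_gt.
  have ok : open (qball rho x0 k%:R) by apply: rho_open; rewrite ltr0n.
  exists (qball rho x0 k%:R, [set n | (k <= n)%N]) => /=.
    by split; [exact: open_nbhs_nbhs|exists k].
  by move=> [y j] /= [yk kj]; apply: (lt_le_trans yk); rewrite ler_nat.
exists (C * (n%:R + n%:R) + 1) => [|x y].
  by rewrite ltr_wpDl// mulr_ge0//; lra.
apply: (le_lt_trans (rtri x x0 y)).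
have := nI x I; have := nI y I; rewrite /qball /= (rsym x) => xn yn.
have : C * (rho x0 x + rho x0 y) <= C * (n%:R + n%:R) by rewrite ler_wpM2l//; lra.
lra.
Qed.

(** [inf] of an empty set would be 0; boundedness of [rho] supplies a ball containing both
    points. *)
Lemma ms_beta_ltP x y r : beta x y < r <->
  exists z t, [/\ 0 < t, rho z x < t, rho z y < t & vol m (qball rho z t) < r].
Proof.
rewrite /ms_beta; set S := [set v | _]; split=> [|[z [t [t0 zx zy vr]]]].
  move=> /inf_lt[|v [z [t [t0 zx zy ->]]] vr].
    have [M M0 rM] := rho_bounded.
    by exists (vol m (qball rho x M)), x, M; split=> //; exact: rM.
  by exists z, t.
apply: le_lt_trans vr; apply: ge_inf; last by exists z, t.
by exists 0 => _ [z' [t' [? ? ? ->]]]; exact: vol_ge0.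
Qed.

Lemma ms_beta_ge0 x y : 0 <= beta x y.
Proof.
have [M M0 rM] := rho_bounded.
apply: lb_le_inf.
  by exists (vol m (qball rho x M)), x, M; split=> //; exact: rM.
by move=> _ [z [t [? ? ? ->]]]; exact: vol_ge0.
Qed.

Lemma ms_beta_sym x y : beta x y = beta y x.
Proof.
congr inf; apply/seteqP; split=> v [z [t [? ? ? ?]]]; by exists z, t.
Qed.

Lemma ms_beta_le1 x y : beta x y <= 1.
Proof.
have [M M0 rM] := rho_bounded.
apply: (@le_trans _ _ (vol m (qball rho x M))); last first.
  by rewrite -lee_fin volK ?le_mass1//; exact: measurable_rball.
apply: ge_inf; last by exists x, M; split=> //; exact: rM.
by exists 0 => _ [z' [t' [? ? ? ->]]]; exact: vol_ge0.
Qed.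

(** A [rho]-ball witnessing beta x y < r witnesses it for all of its points, so a [beta]-ball is a
    union of [rho]-balls. *)
Lemma open_ms_ball x r : open (qball beta x r).
Proof.
have -> : qball beta x r = \bigcup_(B in [set B | exists z t,
   [/\ 0 < t, rho z x < t, vol m (qball rho z t) < r & B = qball rho z t]]) B.
  apply/seteqP; split=> y.
    move=> /ms_beta_ltP[z [t [t0 zx zy vr]]].
    by exists (qball rho z t) => //; exists z, t.
  by move=> [_ [z [t [t0 zx vr ->]]] zy]; apply/ms_beta_ltP; exists z, t.
by apply: bigcup_open => _ [z [t [t0 _ _ ->]]]; exact: rho_open.
Qed.

Lemma measurable_ms_ball x r : measurable (qball beta x r : set (borelType X)).
Proof. apply: borel_open; exact: open_ms_ball. Qed.

Lemma doubling_iter : exists2 C : R, 1 <= C & forall n x t, 0 < t ->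
  vol m (qball rho x (2 ^+ n * t)) <= C ^+ n * vol m (qball rho x t).
Proof.
case: (rhoH) => _ _ _ [C C0 dbl].
have step x t : 0 < t -> vol m (qball rho x (2 * t)) <= C * vol m (qball rho x t).
  move=> t0; have [_ + _] := dbl x (2 * t) (mulr_gt0 (ltr0Sn R 1) t0).
  rewrite (_ : 2 * t / 2 = t); last lra.
  move=> /ltW.
  have m2 := measurable_rball x (mulr_gt0 (ltr0Sn R 1) t0).
  by rewrite -(volK mI m2) -(volK mI (measurable_rball x t0)) -EFinM lee_fin.
exists (Num.max 1 C) => [|n x t t0]; first by rewrite le_max lexx.
elim: n => [|n IHn]; first by rewrite !expr0 !mul1r.
rewrite !exprS -mulrA; apply: (le_trans (step _ _ _)).
  by rewrite mulr_gt0// exprn_gt0.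
rewrite -mulrA ler_pM ?vol_ge0//; first exact: ltW.
by rewrite le_max lexx orbT.
Qed.

Lemma pow2_ge (x : R) : exists n, x <= 2 ^+ n.
Proof.
exists (Num.trunc x).+1; apply: (@le_trans _ _ (Num.trunc x).+1%:R).
  exact/ltW/truncnS_gt.
by rewrite -natrX ler_nat; exact/ltnW/ltn_expl.
Qed.

(** Among the [rho]-balls through x of volume below r, one has more than half of the largest
    possible radius. A fixed dilate of it contains all the others, and doubling bounds the volume of
    the dilate. *)
Lemma vol_ms_ball_le : exists2 K : R, 0 < K & forall x r, 0 < r ->
  vol m (qball beta x r) <= K * r.
Proof.
have [C C1 dbl] := doubling_iter.
case: (rhoH) => -[rge0 rxx _ rsym [A A1 rtri]] _ _ _.
(* Here rho z x < t, and rho x y <= 2 A t' < 4 A t for a competing ball of radius t' < 2 t, so the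
   quasi-triangle inequality gives rho z y < 5 A^2 t. *)
have [n An] := pow2_ge (5 * A ^+ 2).
have [M M0 rM] := rho_bounded.
have C0 : 0 < C by lra.
exists (Num.max 1 (C ^+ n)) => [|x r r0]; first by rewrite lt_max ltr01.
have [r1|r1] := ltP 1 r.
  apply: (@le_trans _ _ 1).
    by rewrite -lee_fin volK ?le_mass1//; exact: measurable_ms_ball.
  by rewrite mulr_ege1 ?(ltW r1)// le_max lexx.
pose S := [set t | 0 < t /\ exists2 z, rho z x < t & vol m (qball rho z t) < r].
have [S0|S0] := pselect (S !=set0); last first.
  have -> : qball beta x r = set0.
    rewrite -subset0 => y /ms_beta_ltP[z [t [t0 zx zy vr]]].
    by apply: S0; exists t; split=> //; exists z.
  by rewrite /vol measure0 mulr_ge0 ?(ltW r0)// le_max ler01.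
(* A ball of radius above [M] is the whole space, whose volume 1 is not below r. *)
have Sb : ubound S M.
  move=> t [t0 [z zx vr]]; rewrite leNgt; apply/negP => Mt.
  suff : vol m (qball rho z t) = 1 by lra.
  rewrite /vol (_ : qball rho z t = setT) ?mI//.
  by apply/seteqP; split=> // y _; apply: lt_trans Mt; exact: rM.
have hS : has_sup S by split=> //; exists M.
have supS0 : 0 < sup S.
  by have [t St] := S0; apply: (@lt_le_trans _ _ t); [case: St|exact: (sup_upper_bound hS St)].
have [t [t0 [z zx vr]] tsup] := sup_adherent (divr_gt0 supS0 (ltr0Sn R 1)) hS.
apply: (@le_trans _ _ (C ^+ n * r)); last first.
  by rewrite ler_wpM2r ?(ltW r0)// le_max lexx orbT.
apply: (@le_trans _ _ (vol m (qball rho z (2 ^+ n * t)))); last first.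
  apply: (le_trans (dbl _ _ _ t0)).
  by rewrite ler_wpM2l ?(ltW vr)// exprn_ge0// ltW.
apply: le_vol => //; first exact: measurable_ms_ball.
  by apply: measurable_rball; rewrite mulr_gt0// exprn_gt0.
move=> y /ms_beta_ltP[z' [t' [t'0 zx' zy' vr']]]; rewrite /qball /=.
have t't : t' < 2 * t.
  have : t' <= sup S by apply: (sup_upper_bound hS); split=> //; exists z'.
  lra.
apply: (le_lt_trans (rtri z x y)).
have h1 : rho x y <= A * (t' + t').
  apply: (le_trans (rtri x z' y)); rewrite ler_wpM2l//; first lra.
  by rewrite lerD// ltW// rsym.
apply: (@lt_le_trans _ _ (5 * A ^+ 2 * t)); last by rewrite ler_wpM2r// ltW.
have := rge0 z x.
have h2 : A * rho x y <= A * (A * (t' + t')) by rewrite ler_wpM2l//; lra.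
have h3 : A * (A * (t' + t')) < A * (A * (4 * t)).
  by rewrite !ltr_pM2l//; lra.
have h4 : A * rho z x <= A * (A * t).
  rewrite ler_wpM2l//; first lra.
  by apply: (le_trans (ltW zx)); rewrite ler_peMl// ltW.
rewrite mulrDr; nra.
Qed.

(** Points being null, the volumes of the dyadic balls about x drop below r at some first step. That
    ball lies in the [beta]-ball of radius r, and its predecessor, of volume at least r, is larger
    by at most the doubling constant. *)
Lemma vol_ms_ball_ge : exists2 K : R, 0 < K & forall x r, 0 < r -> r <= 1 ->
  r <= K * vol m (qball beta x r).
Proof.
have [C C1 dbl] := doubling_iter.
have [M M0 rM] := rho_bounded.
exists C => [|x r r0 r1]; first lra.
pose B n := qball rho x (M / 2 ^+ n).
have MB n : 0 < M / 2 ^+ n by rewrite divr_gt0// exprn_gt0.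
have mB n : measurable (B n : set (borelType X)) by exact: measurable_rball.
have B0 : vol m (B 0%N) = 1.
  rewrite /vol (_ : B 0%N = setT) ?mI//.
  by apply/seteqP; split=> // y _; rewrite /B /qball /= expr0 divr1.
have [n nr] : exists n, vol m (B n) < r.
  have capB : \bigcap_n B n = [set x].
    case: (rhoH) => -[rge0 rxx rpos _ _] _ _ _.
    apply/seteqP; split=> [y By|_ -> n _]; last by rewrite /B /qball /= rxx.
    apply: contrapT => /nesym xy; have rxy := rpos _ _ xy.
    have [n Mn] := pow2_ge (M / rho x y).
    have := By n I; rewrite /B /qball /= ltr_pdivlMr ?exprn_gt0// mulrC ltNge.
    by rewrite -ler_pdivrMr// Mn.
  have := @nonincreasing_cvg_mu _ _ _ m B; rewrite capB m1.
  case/(_ _ _ _ _)/fine_cvgP => //.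
  - by rewrite (le_lt_trans (le_mass1 mI (mB 0%N)) (ltry _)).
  - by rewrite -capB; exact: bigcap_measurable.
  - apply/nonincreasing_seqP => n; apply/subsetPset => y; rewrite /B /qball /= => /lt_le_trans; apply.
    rewrite ler_pM2l// lef_pV2 ?posrE ?exprn_gt0//.
    by rewrite exprS ler_peMl ?exprn_ge0//; lra.
  - move=> _ /cvgrPdist_lt/(_ _ r0)[n _ /(_ n (leqnn n))] /=.
    by rewrite sub0r normrN => h; exists n; apply: le_lt_trans h; exact: ler_norm.
have exn : exists n, vol m (B n) < r by exists n.
(* The first index is not 0, because [B 0] has volume 1 and r <= 1. *)
case: (ex_minnP exn) => -[|k] kr kmin; first by move: kr; rewrite B0; lra.
have rk : r <= vol m (B k).
  by rewrite leNgt; apply/negP => /kmin; rewrite ltnn.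
apply: (le_trans rk).
have := dbl 1%N x _ (MB k.+1).
rewrite !expr1 (_ : 2 * (M / 2 ^+ k.+1) = M / 2 ^+ k); last first.
  by rewrite exprS invfM mulrCA mulVKf.
move/le_trans; apply.
rewrite ler_wpM2l//; first lra.
apply: (le_vol mI (mB k.+1)); first exact: measurable_ms_ball.
move=> y xy; apply/ms_beta_ltP; exists x, (M / 2 ^+ k.+1); split=> //.
by case: (rhoH) => -[_ -> _ _ _] _ _ _.
Qed.

End MaciasSegovia.

(** * Regular grids *)

Section RegularGrid.
Context {d : measure_display} {T : measurableType d} {R : realType}.
Variable m : {measure set T -> \bar R}.

(* A single constant [K] serves in all the bounds, including the quasi-triangle
   inequality; level 0 is covered as well, being a finite family. *)
Record regular_grid (beta : T -> T -> R) (K lam : R) (z : nat -> set T -> T)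
    (Pg : nat -> set (set T)) : Prop := RegularGrid {
  rg_K : 1 <= K;
  rg_lam : 0 < lam < 1;
  rg_ge0 : forall x y, 0 <= beta x y;
  rg_xx : forall x, beta x x = 0;
  rg_sym : forall x y, beta x y = beta y x;
  rg_tri : quasi_triangle K beta;
  rg_ball : forall x r, measurable (qball beta x r);
  rg_vball : forall x r, 0 < r -> vol m (qball beta x r) <= K * r;
  rg_mT : m [set: T] = 1%E;
  rg_fin : forall k, finite_set (Pg k);
  rg_meas : forall k Q, Pg k Q -> measurable Q;
  rg_pos : forall k Q, Pg k Q -> (0 < m Q)%E;
  rg_part : forall k, ae_partition m (Pg k);
  rg_nest : forall k Q, Pg k.+1 Q -> exists2 P, Pg k P & Q `<=` P;
  rg_z : forall k Q, Pg k Q -> Q (z k Q);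
  rg_diam : forall k Q x y, Pg k Q -> Q x -> Q y -> beta x y <= K * lam ^+ k;
  rg_vol : forall k Q, Pg k Q -> lam ^+ k <= K * vol m Q }.

End RegularGrid.

Definition cells {T : Type} (Pg : nat -> set (set T)) k : seq (set T) :=
  finmap.enum_fset (fset_set (Pg k)).

(** For a cell [Q] of level at least [k] there is exactly one candidate, so the choice made by
    [xget] is harmless. *)
Definition anc {T : Type} (Pg : nat -> set (set T)) k (Q : set T) : set T :=
  xget set0 [set P | Pg k P /\ Q `<=` P].

Section RegularGridTheory.
Context {d : measure_display} {T : measurableType d} {R : realType}.
Context {m : {measure set T -> \bar R}} {beta : T -> T -> R} {K lam : R}.
Context {z : nat -> set T -> T} {Pg : nat -> set (set T)}.
Hypothesis rg : regular_grid m beta K lam z Pg.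
Implicit Types (k j : nat) (P Q : set T) (x y : T) (L : R).

Lemma rg_K0 : 0 < K.
Proof. by have := rg_K rg; lra. Qed.

Lemma rg_lamX k : 0 < lam ^+ k.
Proof. by rewrite exprn_gt0//; case/andP: (rg_lam rg). Qed.

Lemma rg_lam_le k j : (k <= j)%N -> lam ^+ j <= lam ^+ k.
Proof. by case/andP: (rg_lam rg) => l0 l1 kj; rewrite ler_wiXn2l// ltW. Qed.

Lemma mem_cells k Q : reflect (Pg k Q) (Q \in cells Pg k).
Proof. by apply: (iffP idP); rewrite /cells in_fset_set ?inE//; apply: (rg_fin rg). Qed.

Lemma cells_uniq k : uniq (cells Pg k).
Proof. exact: finmap.fset_uniq. Qed.

Lemma fsum_cells (V : nmodType) k (F : set T -> V) :
  \sum_(Q \in Pg k) F Q = \sum_(Q <- cells Pg k) F Q.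
Proof. by rewrite fsbig_finite//; apply: (rg_fin rg). Qed.

Lemma cell_vol_gt0 k Q : Pg k Q -> 0 < vol m Q.
Proof.
by move=> kQ; apply: vol_gt0; [exact: (rg_mT rg)|exact: (rg_meas rg kQ)|exact: (rg_pos rg kQ)].
Qed.

Lemma cell_ball k Q x (L : R) : Pg k Q -> beta x (z k Q) <= L * lam ^+ k ->
  Q `<=` qball beta x ((K * (L + K) + 1) * lam ^+ k).
Proof.
move=> kQ xz y Qy; rewrite /qball /=.
apply: (le_lt_trans (rg_tri rg x (z k Q) y)).
have := rg_diam rg kQ (rg_z rg kQ) Qy; have := rg_lamX k; have := rg_K rg.
set l := lam ^+ k in xz *; set b := beta _ _ in xz *; set b' := beta _ _ => K1 l0 yz.
have : K * (b + b') <= K * (L * l + K * l) by rewrite ler_wpM2l; lra.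
lra.
Qed.

Lemma cell_vol_le k Q : Pg k Q -> vol m Q <= K * (K * K + 1) * lam ^+ k.
Proof.
move=> kQ; have K0 := rg_K0; have l0 := rg_lamX k.
rewrite -mulrA; apply: (@le_trans _ _ (vol m (qball beta (z k Q) ((K * K + 1) * lam ^+ k)))).
  apply: (le_vol (rg_mT rg) (rg_meas rg kQ) (rg_ball rg _ _)).
  by have := @cell_ball k Q (z k Q) 0 kQ; rewrite add0r mul0r (rg_xx rg); apply.
by apply: (rg_vball rg); rewrite mulr_gt0// addr_gt0// mulr_gt0.
Qed.

(** Volume packing: the cells counted are disjoint up to null sets, each has volume at least lam^k /
    K, and all lie in one ball of volume O(lam^k). *)
Lemma count_near_cells (L : R) : 0 <= L -> exists N : nat, forall k x,
  (count (fun Q => `[< (beta x (z k Q) <= L * lam ^+ k)%R >]) (cells Pg k) <= N)%N.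
Proof.
move=> L0; have K0 := rg_K0.
pose B := K * (K * (K * (L + K) + 1)); exists (Num.trunc B).+1 => k x.
set P := fun Q => _; have l0 := rg_lamX k.
have h : \sum_(Q <- cells Pg k | P Q) vol m Q <= K * ((K * (L + K) + 1) * lam ^+ k).
  apply: le_trans (rg_vball rg x _); last first.
    by rewrite mulr_gt0// addr_gt0// mulr_gt0// ltr_wpDl.
  apply: (ae_disjoint_vol_sum (rg_mT rg)).
  - exact: cells_uniq.
  - by move=> Q /mem_cells kQ _; exact: (rg_meas rg kQ).
  - by move=> A B' /mem_cells kA /mem_cells kB; case: (rg_part rg k) => _; apply.
  - by move=> Q /mem_cells kQ /asboolP; exact: cell_ball.
  - exact: (rg_ball rg).
have {}h : (count P (cells Pg k))%:R * lam ^+ k <= B * lam ^+ k.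
  apply: (@le_trans _ _ (K * \sum_(Q <- cells Pg k | P Q) vol m Q)).
    rewrite mulr_sumr mulr_natl -iter_addr_0 -big_const_seq.
    rewrite big_seq_cond [leRHS]big_seq_cond ler_sum// => Q /andP[/mem_cells kQ _].
    exact: (rg_vol rg kQ).
  by rewrite /B -!mulrA ler_wpM2l ?(ltW K0)// mulrA.
rewrite ler_pM2r// in h; rewrite -(ler_nat R); apply: (le_trans h).
exact/ltW/truncnS_gt.
Qed.

(** Two different cells of level [k] meet in a null set, which cannot contain [Q], a set of positive
    measure. *)
Lemma anc_uniq k j P Q : Pg j Q -> Pg k P -> Q `<=` P -> anc Pg k Q = P.
Proof.
move=> jQ kP QP; rewrite /anc; case: xgetP => [P' _ [kP' QP']|/(_ P)]; last by case.
apply: contrapT => PP'; have [_ /(_ _ _ kP' kP PP') m0] := rg_part rg k.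
have : (m Q <= 0)%E.
  rewrite -m0; apply: le_measure; rewrite ?inE.
  - exact: (rg_meas rg jQ).
  - by apply: measurableI; [exact: (rg_meas rg kP')|exact: (rg_meas rg kP)].
  - by move=> x Qx; split; [exact: QP'|exact: QP].
by rewrite leNgt (rg_pos rg jQ).
Qed.

Lemma anc_ex k j Q : (k <= j)%N -> Pg j Q -> exists2 P, Pg k P & Q `<=` P.
Proof.
move=> /subnK; move: (j - k)%N => i; elim: i j Q => [|i IHi] j Q <-; first by exists Q.
rewrite addSn => /(rg_nest rg)[Q' jQ' QQ'].
have [P kP Q'P] := IHi _ _ erefl jQ'.
by exists P => //; apply: subset_trans QQ' Q'P.
Qed.

Lemma anc_in k j Q : (k <= j)%N -> Pg j Q -> Pg k (anc Pg k Q).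
Proof. by move=> kj jQ; have [P kP /(anc_uniq jQ kP)->] := anc_ex kj jQ. Qed.

Lemma anc_sub k j Q : (k <= j)%N -> Pg j Q -> Q `<=` anc Pg k Q.
Proof. by move=> kj jQ; have [P kP QP] := anc_ex kj jQ; rewrite (anc_uniq jQ kP QP). Qed.

Lemma anc_id k Q : Pg k Q -> anc Pg k Q = Q.
Proof. by move=> kQ; exact: (anc_uniq kQ kQ). Qed.

Lemma anc_anc k i j Q : (k <= i)%N -> (i <= j)%N -> Pg j Q ->
  anc Pg k (anc Pg i Q) = anc Pg k Q.
Proof.
move=> ki ij jQ; have iP := anc_in ij jQ.
apply/esym/(anc_uniq jQ); first exact: (anc_in ki iP).
by apply: (subset_trans (anc_sub ij jQ)); exact: (anc_sub _ iP).
Qed.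

End RegularGridTheory.

(** * Power sums of the discrete majorants *)

Section SpreadEstimate.
Context {d : measure_display} {T : measurableType d} {R : realType}.
Context {m : {measure set T -> \bar R}} {beta : T -> T -> R} {K lam : R}.
Context {z : nat -> set T -> T} {Pg : nat -> set (set T)}.
Hypothesis rg : regular_grid m beta K lam z Pg.
Implicit Types (k j : nat) (P Q : set T) (x y : T).

Definition close (L : R) k Q P := exists2 x, Q x & beta x (z k P) <= L * lam ^+ k.

Definition near_sum (L : R) (v : nat -> set T -> R) k Q :=
  \sum_(P <- cells Pg k | `[< close L k Q P >]) v k P.

(** Common majorant of the new level-j coefficients in both directions, before their normalisation
    by |Q|^(1/p-s): [v] is the size of the old terms and [w] the gain from the gap between the
    levels. *)
Definition spread (L : R) (w : nat -> nat -> set T -> R) v j Q :=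
  \sum_(k < j.+1) w k j Q * near_sum L v k Q.

Lemma near_sum_ge0 L v k Q : (forall k P, 0 <= v k P) -> 0 <= near_sum L v k Q.
Proof. by move=> v0; exact: sumr_ge0. Qed.

Lemma spread_ge0 L w v j Q : (forall k j Q, 0 <= w k j Q) ->
  (forall k P, 0 <= v k P) -> 0 <= spread L w v j Q.
Proof. by move=> w0 v0; apply: sumr_ge0 => k _; rewrite mulr_ge0// near_sum_ge0. Qed.

(** As [Q] has diameter at most K lam^k, every cell counted is near the single point [z j Q]. *)
Lemma count_close (L : R) : 0 <= L -> exists N : nat, forall k j Q, (k <= j)%N -> Pg j Q ->
  (count (fun P => `[< close L k Q P >]) (cells Pg k) <= N)%N.
Proof.
move=> L0; have K1 := rg_K rg.
have K0 := rg_K0 rg.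
have LK0 : 0 <= K * (L + K) by rewrite mulr_ge0//; lra.
have [N HN] := count_near_cells rg LK0.
exists N => k j Q kj jQ; apply: leq_trans (HN k (z j Q)).
apply: sub_count => P /asboolP[x Qx xP]; apply/asboolP.
apply: (le_trans (rg_tri rg _ x _)); rewrite -mulrA ler_wpM2l ?(ltW K0)// mulrDl addrC lerD//.
apply: (le_trans (rg_diam rg jQ (rg_z rg jQ) Qx)).
by rewrite ler_wpM2l ?(ltW K0)//; exact: (rg_lam_le rg kj).
Qed.

Variables (p : R).
Hypothesis p1 : 1 <= p.

Let p0 : 0 < p. Proof. by have := p1; lra. Qed.

(** Few cells P are close to a given Q, so the p-th power passes inside the near sum. After
    exchanging the sums, the Q close to a fixed P are grouped by their level-k ancestors: boundedly
    many ancestors occur, and the hypothesis on [w] controls each group. The factor lam^k comes from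
    the volume of an ancestor. *)
Lemma spread_level_estimate (L Kw tau : R) w : 0 <= L -> 0 <= Kw -> 0 <= tau ->
  (forall k j Q, 0 <= w k j Q) ->
  (forall k j P, (k <= j)%N -> Pg k P ->
     \sum_(Q <- cells Pg j | anc Pg k Q == P) vol m Q * w k j Q `^ p
       <= Kw * tau ^+ (j - k) * vol m P) ->
  exists2 C, 0 <= C & forall v k j, (forall k P, 0 <= v k P) -> (k <= j)%N ->
   \sum_(Q <- cells Pg j) vol m Q * (w k j Q * near_sum L v k Q) `^ p
    <= C * tau ^+ (j - k) * lam ^+ k * \sum_(P <- cells Pg k) v k P `^ p.
Proof.
move=> L0 Kw0 tau0 w0 wE.
have K1 := rg_K rg; have K0 := rg_K0 rg.
have [N HN] := count_close L0.
have LK0 : 0 <= K * (L + K) by rewrite mulr_ge0//; lra.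
have [N' HN'] := count_near_cells rg LK0.
have [V V0 volV] : exists2 V, 0 <= V & forall k P, Pg k P -> vol m P <= V * lam ^+ k.
  exists (K * (K * K + 1)) => [|k P kP]; last exact: (cell_vol_le rg kP).
  by rewrite mulr_ge0 ?addr_ge0 ?mulr_ge0//; lra.
exists (N%:R `^ p * (N'%:R * (Kw * V))).
  by rewrite !mulr_ge0 ?powR_ge0.
move=> v k j v0 kj.
have l0 := rg_lamX rg k.
have volK0 Q : 0 <= vol m Q := vol_ge0 m Q.
pose W Q := vol m Q * w k j Q `^ p.
have W0 Q : 0 <= W Q by rewrite mulr_ge0 ?powR_ge0.
pose B := N'%:R * (Kw * V) * tau ^+ (j - k) * lam ^+ k.
have inner P : Pg k P -> \sum_(Q <- cells Pg j | `[< close L k Q P >]) W Q <= B.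
  move=> kP.
  (* The ancestor of a cell close to [P] has its centre this near to that of [P]. *)
  pose D P' := `[< beta (z k P) (z k P') <= K * (L + K) * lam ^+ k >].
  apply: (@le_trans _ _ (\sum_(P' <- cells Pg k | D P')
      \sum_(Q <- cells Pg j | anc Pg k Q == P') W Q)).
    have -> : \sum_(P' <- cells Pg k | D P') \sum_(Q <- cells Pg j | anc Pg k Q == P') W Q =
        \sum_(Q <- cells Pg j) \sum_(P' <- cells Pg k | D P')
          (if anc Pg k Q == P' then W Q else 0).
      by rewrite [RHS]exchange_big; apply: eq_bigr => P' _; rewrite big_mkcond.
    rewrite big_mkcond /= [leLHS]big_seq [leRHS]big_seq.
    apply: ler_sum => Q /(mem_cells rg) jQ.
    have sum0 (r : seq (set T)) (E : pred (set T)) :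
       0 <= \sum_(P' <- r | E P') (if anc Pg k Q == P' then W Q else 0).
      by apply: sumr_ge0 => P' _; case: ifP.
    case: asboolP => [[x Qx xP]|_]; last exact: sum0.
    have kA := anc_in rg kj jQ; have Ax := anc_sub rg kj jQ Qx.
    rewrite (big_rem (anc Pg k Q)) /=; last exact/(mem_cells rg).
    rewrite eqxx ifT ?lerDl//; apply/asboolP.
    apply: (le_trans (rg_tri rg _ x _)); rewrite -mulrA ler_wpM2l ?(ltW K0)// mulrDl lerD//.
      by rewrite (rg_sym rg).
    exact: (rg_diam rg kA Ax (rg_z rg kA)).
  apply: (@le_trans _ _ (\sum_(P' <- cells Pg k | D P') Kw * tau ^+ (j - k) * (V * lam ^+ k))).
    rewrite big_seq_cond [leRHS]big_seq_cond; apply: ler_sum => P' /andP[/(mem_cells rg) kP' _].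
    apply: (le_trans (wE _ _ _ kj kP')); rewrite ler_wpM2l ?mulr_ge0 ?exprn_ge0//.
    exact: volV.
  rewrite big_const_seq iter_addr_0 -[leLHS]mulr_natl.
  apply: (@le_trans _ _ (N'%:R * (Kw * tau ^+ (j - k) * (V * lam ^+ k)))).
    rewrite ler_wpM2r//; last by rewrite ler_nat; exact: HN'.
    by rewrite !mulr_ge0 ?exprn_ge0//; case/andP: (rg_lam rg) => /ltW.
  by rewrite le_eqVlt; apply/orP; left; apply/eqP; rewrite /B; ring.
apply: (@le_trans _ _ (\sum_(Q <- cells Pg j) N%:R `^ p *
   \sum_(P <- cells Pg k | `[< close L k Q P >]) W Q * v k P `^ p)).
  rewrite big_seq [leRHS]big_seq; apply: ler_sum => Q /(mem_cells rg) jQ.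
  rewrite -mulr_sumr powRM//; last exact: near_sum_ge0.
  rewrite mulrA -/(W Q) [leRHS]mulrCA ler_wpM2l//.
  by apply: powR_sum_overlap => //; exact: (HN _ _ _ kj jQ).
rewrite -mulr_sumr.
have -> (X : R) : N%:R `^ p * (N'%:R * (Kw * V)) * tau ^+ (j - k) * lam ^+ k * X
    = N%:R `^ p * (B * X) by rewrite /B !mulrA.
rewrite ler_wpM2l ?powR_ge0//.
have -> : \sum_(Q <- cells Pg j) \sum_(P <- cells Pg k | `[< close L k Q P >]) W Q * v k P `^ p
    = \sum_(P <- cells Pg k) \sum_(Q <- cells Pg j | `[< close L k Q P >]) W Q * v k P `^ p.
  under eq_bigr => Q _ do rewrite big_mkcond.
  by rewrite exchange_big; apply: eq_bigr => P _; rewrite -big_mkcond.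
rewrite mulr_sumr.
rewrite big_seq [leRHS]big_seq; apply: ler_sum => P /(mem_cells rg) kP.
rewrite -mulr_suml ler_wpM2r ?powR_ge0//.
exact: (inner _ kP).
Qed.

Lemma powR_exprn (e : R) k : (lam ^+ k) `^ e = (lam `^ e) ^+ k.
Proof. by apply: powR_exprC; case/andP: (rg_lam rg) => /ltW. Qed.

Lemma cell_vol_powRN_le (e : R) k Q : 0 <= e -> Pg k Q ->
  vol m Q `^ (- e) <= K `^ e * (lam ^+ k) `^ (- e).
Proof.
move=> e0 kQ; have v0 := cell_vol_gt0 rg kQ; have l0 := rg_lamX rg k.
rewrite !powRN ler_pdivlMr ?powR_gt0// mulrC ler_pdivrMr ?powR_gt0//.
rewrite -powRM ?(ltW v0) ?(ltW (rg_K0 rg))//.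
by rewrite le_powR ?(ltW l0)//; exact: (rg_vol rg kQ).
Qed.

(** The normalisation contributes |Q|^(-sp), at most of order lam^(-spj), and the old atoms
    |P|^(sp-1), at most of order lam^(-(1-sp)k). Together with the factor tau^(j-k) lam^k of each
    level this leaves (tau lam^(-sp))^(j-k). *)
Lemma spread_coef_estimate (L Kw tau s : R) w : 0 <= L -> 0 <= Kw -> 0 < tau ->
  0 < s < p^-1 -> tau * lam `^ (- (s * p)) < 1 ->
  (forall k j Q, 0 <= w k j Q) ->
  (forall k j P, (k <= j)%N -> Pg k P ->
     \sum_(Q <- cells Pg j | anc Pg k Q == P) vol m Q * w k j Q `^ p
       <= Kw * tau ^+ (j - k) * vol m P) ->
  exists C t, [/\ 0 <= C, 0 < t < 1 & forall a j, (forall k P, 0 <= a k P) ->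
    \sum_(Q <- cells Pg j) (spread L w (fun k P => a k P * vol m P `^ (s - p^-1)) j Q
       * vol m Q `^ (p^-1 - s)) `^ p
    <= C * \sum_(k < j.+1) t ^+ (j - k) * \sum_(P <- cells Pg k) a k P `^ p].
Proof.
move=> L0 Kw0 tau0 /andP[s0 sp] taulam w0 wE.
have [C1 C10 HC1] := spread_level_estimate L0 Kw0 (ltW tau0) w0 wE.
have K0 := rg_K0 rg; have lam0 : 0 < lam by case/andP: (rg_lam rg).
have sp0 : 0 <= s * p by rewrite mulr_ge0// ltW.
have sp1 : s * p < 1 by rewrite -ltr_pdivlMr// mul1r.
set La := lam `^ (- (s * p)) in taulam.
have La0 : 0 < La by exact: powR_gt0.
have u0 : 0 < tau * La by rewrite mulr_gt0.
(* 1 + dl is the midpoint of 1 and (tau La)^(-1/p), so the loss [mu] per level keeps mu tau La below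
   1. *)
pose dl := ((tau * La) `^ (- p^-1) - 1) / 2.
have pV0 : 0 < p^-1 by rewrite invr_gt0.
have uV : 1 < (tau * La) `^ (- p^-1).
  rewrite powRN invf_gt1 ?powR_gt0// -[ltRHS](powR1r p^-1) gt0_ltr_powR// ?nnegrE//.
  exact: ltW.
have dl0 : 0 < dl by rewrite /dl; lra.
pose mu := (1 + dl) `^ p.
have mu0 : 0 < mu by apply: powR_gt0; lra.
have t1 : mu * (tau * La) < 1.
  rewrite -ltr_pdivlMr// mul1r (_ : (tau * La)^-1 = ((tau * La) `^ (- p^-1)) `^ p).
    by rewrite gt0_ltr_powR// ?nnegrE ?powR_ge0// /dl; lra.
  by rewrite -powRrM mulNr mulVf ?lt0r_neq0// powR_inv1// ltW.
pose C2 := (1 + dl^-1) `^ p.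
pose C := K `^ (s * p) * C2 * mu * C1 * K `^ (1 - s * p).
have C20 : 0 <= C2 by exact: powR_ge0.
have C0 : 0 <= C by rewrite /C !mulr_ge0 ?powR_ge0// ltW.
exists C, (mu * (tau * La)); split=> //; first by rewrite t1 andbT mulr_gt0.
move=> a j a0.
pose v k P := a k P * vol m P `^ (s - p^-1).
have v0 k P : 0 <= v k P by rewrite mulr_ge0 ?powR_ge0.
have E0 k Q : 0 <= w k j Q * near_sum L v k Q by rewrite mulr_ge0// near_sum_ge0.
have vol0 Q : 0 <= vol m Q := vol_ge0 m Q.
apply: (@le_trans _ _ (\sum_(Q <- cells Pg j) K `^ (s * p) * La ^+ j *
   (C2 * \sum_(k < j.+1) mu ^+ (j.+1 - k) *
      (vol m Q * (w k j Q * near_sum L v k Q) `^ p)))).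
  rewrite big_seq [leRHS]big_seq; apply: ler_sum => Q /(mem_cells rg) jQ.
  have vQ := cell_vol_gt0 rg jQ.
  rewrite powRM ?powR_ge0//; last exact: spread_ge0.
  have -> : (vol m Q `^ (p^-1 - s)) `^ p = vol m Q * vol m Q `^ (- (s * p)).
    rewrite -powRrM mulrBl mulVf ?lt0r_neq0// powRD ?powRr1//.
    by rewrite lt0r_neq0// implybT.
  apply: (@le_trans _ _ ((C2 * \sum_(k < j.+1) mu ^+ (j.+1 - k) *
      (w k j Q * near_sum L v k Q) `^ p) * (vol m Q * (K `^ (s * p) * La ^+ j)))).
    apply: ler_pM; rewrite ?powR_ge0 ?mulr_ge0 ?powR_ge0//.
      exact: (powR_sum_geometric j.+1 p0 dl0 (fun k => E0 k Q)).
    rewrite ler_wpM2l// (le_trans (cell_vol_powRN_le sp0 jQ))//.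
    by rewrite powR_exprn.
  rewrite le_eqVlt; apply/orP; left; apply/eqP.
  under [in RHS]eq_bigr => k _ do rewrite mulrCA.
  rewrite -mulr_sumr; set S := \sum_(_ < _) _; ring.
rewrite -mulr_sumr -mulr_sumr exchange_big /=.
under eq_bigr => k _ do rewrite -mulr_sumr.
rewrite mulrA !mulr_sumr; apply: ler_sum => -[k] /=; rewrite ltnS => kj _.
have lk := rg_lamX rg k.
apply: (@le_trans _ _ (K `^ (s * p) * La ^+ j * C2 * (mu ^+ (j.+1 - k) *
   (C1 * tau ^+ (j - k) * lam ^+ k *
     (K `^ (1 - s * p) * (lam ^+ k) `^ (- (1 - s * p)) * \sum_(P <- cells Pg k) a k P `^ p))))).
  rewrite ler_wpM2l ?mulr_ge0 ?powR_ge0 ?exprn_ge0 ?(ltW La0)//.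
  rewrite ler_wpM2l ?exprn_ge0 ?(ltW mu0)//.
  apply: (le_trans (HC1 v k j v0 kj)).
  rewrite ler_wpM2l ?mulr_ge0 ?exprn_ge0 ?(ltW tau0) ?(ltW lam0)//.
  rewrite mulr_sumr big_seq [leRHS]big_seq; apply: ler_sum => P /(mem_cells rg) kP.
  rewrite powRM ?powR_ge0// mulrC ler_wpM2r ?powR_ge0//.
  rewrite -powRrM mulrBl mulVf ?lt0r_neq0// -opprB; apply: cell_vol_powRN_le => //.
  lra.
rewrite le_eqVlt; apply/orP; left; apply/eqP.
have -> : (lam ^+ k) `^ (- (1 - s * p)) = (lam ^+ k)^-1 * (La ^+ k)^-1.
  rewrite opprB addrC powRD; last by rewrite lt0r_neq0// implybT.
  by rewrite powR_inv1 ?(ltW lk)// /La -powR_exprn powRN invrK.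
rewrite subSn// exprS !exprMn.
have -> : La ^+ j = La ^+ (j - k) * La ^+ k by rewrite -exprD subnK.
have : La ^+ k != 0 by rewrite expf_neq0 ?lt0r_neq0.
have : lam ^+ k != 0 by rewrite lt0r_neq0.
set S := \sum_(_ <- _) _; rewrite /C => ? ?; field.
by apply/andP; split.
Qed.

End SpreadEstimate.

(** * Convergence in Lp *)

Section ComplexModulus.
Context {R : realType}.
Implicit Types u v : R[i].

Lemma cmodE u : cmod u = Num.sqrt (complex.Re u ^+ 2 + complex.Im u ^+ 2).
Proof. by case: u. Qed.

Lemma cmod_ge0 u : 0 <= cmod u.
Proof. by rewrite cmodE sqrtr_ge0. Qed.

Lemma cmod0 : cmod (0 : R[i]) = 0.
Proof. exact: ComplexField.Normc.normc0. Qed.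

Lemma cmodM u v : cmod (u * v) = cmod u * cmod v.
Proof. exact: ComplexField.Normc.normcM. Qed.

Lemma cmodD u v : cmod (u + v) <= cmod u + cmod v.
Proof. exact: le_normcD. Qed.

Lemma cmodN u : cmod (- u) = cmod u.
Proof. exact: normcN. Qed.

Lemma cmodB u v : cmod (u - v) <= cmod u + cmod v.
Proof. by rewrite -(cmodN v) cmodD. Qed.

Lemma cmod_real (a : R) : cmod a%:C%C = `|a|.
Proof. by rewrite cmodE /= expr0n addr0 sqrtr_sqr. Qed.

Lemma cmod_sum (J : Type) (r : seq J) (P : pred J) (F : J -> R[i]) :
  cmod (\sum_(i <- r | P i) F i) <= \sum_(i <- r | P i) cmod (F i).
Proof.
elim/big_rec2: _ => [|i y x _ xy]; first by rewrite cmod0.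
by apply: (le_trans (cmodD _ _)); rewrite lerD2l.
Qed.

End ComplexModulus.

Section ComplexMeasurable.
Context {d : measure_display} {T : measurableType d} {R : realType}.
Implicit Types f g : T -> R[i].

Definition cmeasurable f :=
  measurable_fun [set: T] (fun x => complex.Re (f x)) /\
  measurable_fun [set: T] (fun x => complex.Im (f x)).

Lemma cmeasurable_cmod f : cmeasurable f -> measurable_fun [set: T] (fun x => cmod (f x)).
Proof.
move=> [mRe mIm].
rewrite (_ : (fun x => _) = (fun x => (complex.Re (f x) ^+ 2 + complex.Im (f x) ^+ 2) `^ 2^-1)).
  apply: (measurableT_comp (measurable_powR _)).
  by apply: measurable_funD; apply: measurable_funX.
by apply/funext => x; rewrite cmodE powR12_sqrt// addr_ge0// sqr_ge0.
Qed.

Lemma cmeasurableD f g : cmeasurable f -> cmeasurable g -> cmeasurable (fun x => f x + g x).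
Proof.
move=> [f1 f2] [g1 g2]; split.
  rewrite (_ : (fun x => _) = (fun x => complex.Re (f x) + complex.Re (g x))).
    exact: measurable_funD.
  by apply/funext => x; case: (f x); case: (g x).
rewrite (_ : (fun x => _) = (fun x => complex.Im (f x) + complex.Im (g x))).
  exact: measurable_funD.
by apply/funext => x; case: (f x); case: (g x).
Qed.

Lemma cmeasurableM f g : cmeasurable f -> cmeasurable g -> cmeasurable (fun x => f x * g x).
Proof.
move=> [f1 f2] [g1 g2]; split.
  rewrite (_ : (fun x => _) = (fun x => complex.Re (f x) * complex.Re (g x)
      - complex.Im (f x) * complex.Im (g x))).
    by apply: measurable_funB; exact: measurable_funM.
  by apply/funext => x; case: (f x); case: (g x).
rewrite (_ : (fun x => _) = (fun x => complex.Re (f x) * complex.Im (g x)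
    + complex.Im (f x) * complex.Re (g x))).
  by apply: measurable_funD; exact: measurable_funM.
by apply/funext => x; case: (f x); case: (g x).
Qed.

Lemma cmeasurable_cst (a : R[i]) : cmeasurable (fun=> a : R[i]).
Proof. by split; exact: measurable_cst. Qed.

Lemma cmeasurable_real (g : T -> R) : measurable_fun [set: T] g ->
  cmeasurable (fun x => (g x)%:C%C).
Proof. by move=> mg; split => //=; exact: measurable_cst. Qed.

Lemma cmeasurableB f g : cmeasurable f -> cmeasurable g -> cmeasurable (fun x => f x - g x).
Proof.
move=> mf mg; rewrite (_ : (fun x => _) = (fun x => f x + (-1) * g x)).
  by apply: cmeasurableD => //; apply: cmeasurableM => //; exact: cmeasurable_cst.
by apply/funext => x; rewrite mulN1r.
Qed.

Lemma cmeasurable_sum (J : eqType) (r : seq J) (F : J -> T -> R[i]) :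
  (forall i, i \in r -> cmeasurable (F i)) -> cmeasurable (fun x => \sum_(i <- r) F i x).
Proof.
elim: r => [|i r IHr] mF.
  rewrite (_ : (fun x => _) = (fun=> 0)); first exact: cmeasurable_cst.
  by apply/funext => x; rewrite big_nil.
rewrite (_ : (fun x => _) = (fun x => F i x + \sum_(j <- r) F j x)).
  apply: cmeasurableD; first by apply: mF; rewrite inE eqxx.
  by apply: IHr => j jr; apply: mF; rewrite inE jr orbT.
by apply/funext => x; rewrite big_cons.
Qed.

End ComplexMeasurable.

Section LpTransfer.
Context {d : measure_display} {T : measurableType d} {R : realType}.
Context {m : {measure set T -> \bar R}} {beta : T -> T -> R} {K lam : R}.
Context {z : nat -> set T -> T} {Pg : nat -> set (set T)}.
Hypothesis rg : regular_grid m beta K lam z Pg.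
Variables (p s : R).
Hypotheses (p1 : 1 <= p) (s0 : 0 < s) (sp : s < p^-1).
Implicit Types (k j : nat) (P Q : set T) (x y : T).

Lemma LpC_cmeasurable f : LpC m p f -> cmeasurable f.
Proof. by case. Qed.

Lemma le_Lnorm (f g : T -> R) : measurable_fun [set: T] f -> measurable_fun [set: T] g ->
  (forall x, 0 <= f x <= g x) ->
  (Lnorm m p%:E (EFin \o f) <= Lnorm m p%:E (EFin \o g))%E.
Proof.
move=> mf mg fg; have p0 : 0 <= p by have := p1; lra.
have f0 x : 0 <= f x by case/andP: (fg x).
have g0 x : 0 <= g x by case/andP: (fg x) => f0' /(le_trans f0').
have E (h : T -> R) x : (`|(EFin \o h) x| `^ p)%E = (`|h x| `^ p)%:E by [].
have mp (h : T -> R) : measurable_fun [set: T] h ->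
    measurable_fun [set: T] (fun x => (`|h x| `^ p)%:E).
  move=> mh; apply/measurable_EFinP; apply: (measurableT_comp (measurable_powR _)).
  exact: measurableT_comp.
rewrite unlock.
apply: gt0_ler_poweR; rewrite ?invr_ge0//.
- by rewrite in_itv; apply/andP; split; [apply: integral_ge0 => x _; exact: poweR_ge0|exact: leey].
- by rewrite in_itv; apply/andP; split; [apply: integral_ge0 => x _; exact: poweR_ge0|exact: leey].
- apply: ge0_le_integral => //; [by move=> x _; exact: poweR_ge0|exact: mp|exact: mp|].
  move=> x _; rewrite !E lee_fin le_powR// !ger0_norm//.
  by case/andP: (fg x).
Qed.

(** Cells near x count, not only those containing x, so that blocks are dominated as well as grid
    atoms. *)
Definition atom_bound (L : R) (e : set T -> R) k x : R :=
  \sum_(Q <- cells Pg k | `[< beta x (z k Q) <= L * lam ^+ k >]) e Q * vol m Q `^ (s - p^-1).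

(** At each point at most [N] terms are present, so the p-th power is bounded by a constant times
    the sum of e_Q^p |Q|^(sp-1) over enlarged cells of measure O(lam^k). Integration leaves
    lam^(spk). *)
Lemma Lp_cnorm_le_atom_bound (L : R) : 0 <= L -> exists2 C, 0 <= C &
  forall k (e : set T -> R) (F : T -> R[i]), (forall Q, 0 <= e Q) -> cmeasurable F ->
  {ae m, forall x, cmod (F x) <= atom_bound L e k x} ->
  (Lp_cnorm m p F <=
    (C * (lam `^ s) ^+ k * (\sum_(Q <- cells Pg k) e Q `^ p) `^ p^-1)%:E)%E.
Proof.
move=> L0; have [N HN] := count_near_cells rg L0.
have K0 := rg_K0 rg; have lam0 : 0 < lam by case/andP: (rg_lam rg).
have p0 : 0 < p by have := p1; lra.
have sp1 : s * p < 1 by rewrite -ltr_pdivlMr// mul1r.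
have [C C0 CE] : exists2 C, 0 <= C & C = N%:R `^ p * (K `^ (1 - s * p) * (K * (L + 1))).
  eexists; last by []; apply: mulr_ge0; rewrite ?powR_ge0//;
    apply: mulr_ge0; rewrite ?powR_ge0//; apply: mulr_ge0; lra.
exists (C `^ p^-1) => [|k e F e0 mF Fe]; first exact: powR_ge0.
have l0 := rg_lamX rg k.
have r0 : 0 < (L + 1) * lam ^+ k by rewrite mulr_gt0//; lra.
(* [L + 1] instead of [L] because balls are defined by a strict inequality. *)
pose B Q := qball beta (z k Q) ((L + 1) * lam ^+ k).
have mB Q : measurable (B Q) := rg_ball rg _ _.
pose b Q : R := N%:R `^ p * (e Q * vol m Q `^ (s - p^-1)) `^ p.
have b0 Q : 0 <= b Q by rewrite mulr_ge0 ?powR_ge0.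
pose S := \sum_(Q <- cells Pg k) e Q `^ p.
have S0 : 0 <= S by apply: sumr_ge0 => Q _; exact: powR_ge0.
suff int_le : (\int[m]_x (`|(cmod (F x))%:E| `^ p) <= (C * (lam ^+ k) `^ (s * p) * S)%:E)%E.
  rewrite /Lp_cnorm unlock.
  have -> : (C `^ p^-1 * (lam `^ s) ^+ k * S `^ p^-1)%:E =
      ((C * (lam ^+ k) `^ (s * p) * S)%:E `^ p^-1)%E.
    rewrite poweR_EFin !powRM ?mulr_ge0 ?powR_ge0// -powRrM mulfK ?lt0r_neq0//.
    by rewrite (powR_exprn rg).
  have pV0 : 0 <= p^-1 by rewrite invr_ge0 ltW.
  apply: gt0_ler_poweR => //; rewrite in_itv /= leey andbT.
    by apply: integral_ge0 => x _; rewrite lee_fin powR_ge0.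
  by rewrite lee_fin !mulr_ge0 ?powR_ge0.
have mFp : measurable_fun [set: T] (fun x => cmod (F x) `^ p).
  by apply: (measurableT_comp (measurable_powR _)); exact: cmeasurable_cmod.
have FE x : (`|(cmod (F x))%:E| `^ p)%E = (cmod (F x) `^ p)%:E.
  by rewrite abse_EFin poweR_EFin ger0_norm ?cmod_ge0.
under eq_integral => x _ do rewrite FE.
have mb Q : measurable_fun [set: T] (fun x => (b Q * \1_(B Q) x)%:E).
  by apply/measurable_EFinP; apply: measurable_funM => //; exact: measurable_indic.
apply: (@le_trans _ _ (\int[m]_x (\sum_(Q <- cells Pg k) (b Q * \1_(B Q) x)%:E))%E).
  apply: ae_ge0_le_integral => //.
  - by move=> x _; rewrite lee_fin powR_ge0.
  - exact/measurable_EFinP.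
  - by move=> x _; rewrite sumEFin lee_fin sumr_ge0// => Q _; rewrite mulr_ge0// indicE.
  - by apply: emeasurable_sum => Q.
  - apply: filterS Fe => x Fx _; rewrite sumEFin lee_fin.
    apply: (@le_trans _ _ (atom_bound L e k x `^ p)).
      by apply: le_powR; rewrite ?cmod_ge0// ltW.
    apply: (le_trans (powR_sum_overlap p0 _ (HN k x))) => [Q|].
      by rewrite mulr_ge0 ?powR_ge0.
    rewrite mulr_sumr big_mkcond /=; apply: ler_sum => Q _.
    case: asboolP => [xQ|_]; last by rewrite mulr_ge0// indicE.
    rewrite indicE mem_set ?mulr1// /B /qball /= (rg_sym rg).
    by apply: (le_lt_trans xQ); rewrite ltr_pM2r//; lra.
rewrite ge0_integral_sum//; last by move=> Q x _; rewrite lee_fin mulr_ge0// indicE.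
have -> : (C * (lam ^+ k) `^ (s * p) * S)%:E =
    (\sum_(Q <- cells Pg k) (C * (lam ^+ k) `^ (s * p) * e Q `^ p)%:E)%E.
  by rewrite sumEFin -mulr_sumr.
rewrite big_seq [leRHS]big_seq; apply: lee_sum => Q /(mem_cells rg) kQ.
under eq_integral => x _ do rewrite EFinM.
rewrite ge0_integralZl_EFin//; last first.
  by apply/measurable_EFinP; exact: measurable_indic.
rewrite integral_indic// setIT -(volK (rg_mT rg) (mB Q)) -EFinM lee_fin.
have h1 : vol m (B Q) <= K * ((L + 1) * lam ^+ k) by exact: (rg_vball rg).
have h2 : (vol m Q `^ (s - p^-1)) `^ p <= K `^ (1 - s * p) * (lam ^+ k) `^ (- (1 - s * p)).
  rewrite -powRrM mulrBl mulVf ?lt0r_neq0// -opprB; apply: (cell_vol_powRN_le rg) => //.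
  lra.
rewrite /b powRM ?powR_ge0//.
apply: (@le_trans _ _ (N%:R `^ p * (e Q `^ p * (K `^ (1 - s * p) * (lam ^+ k) `^ (- (1 - s * p))))
    * (K * ((L + 1) * lam ^+ k)))).
  apply: ler_pM => //; rewrite ?vol_ge0// ?mulr_ge0 ?powR_ge0//.
  by rewrite ler_wpM2l ?powR_ge0// ler_wpM2l ?powR_ge0.
have -> : (lam ^+ k) `^ (s * p) = (lam ^+ k) `^ (- (1 - s * p)) * lam ^+ k.
  have {1}-> : s * p = - (1 - s * p) + 1 by ring.
  by rewrite powRD ?powRr1 ?(ltW l0)// lt0r_neq0// implybT.
by rewrite le_eqVlt; apply/orP; left; apply/eqP; rewrite CE; ring.
Qed.

(** The new terms and the gaps between the two partial sums have Lp norms O(lam^(sk)), a summable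
    sequence since s > 0. The first fact gives absolute convergence, the second, with Minkowski's
    inequality, the same limit. *)
Lemma Lp_abs_sum_transfer (L M : R) (e : nat -> set T -> R) u u' f : 0 <= L ->
  LpC m p f -> Lp_abs_sum m p u f -> (forall k, cmeasurable (u' k)) ->
  (forall k Q, 0 <= e k Q) -> (forall k, \sum_(Q <- cells Pg k) e k Q `^ p <= M) ->
  (forall k, {ae m, forall x, cmod (u' k x) <= atom_bound L (e k) k x}) ->
  (forall k, {ae m, forall x, cmod (\sum_(i < k.+1) u i x - \sum_(i < k.+1) u' i x)
     <= atom_bound L (e k) k x}) ->
  Lp_abs_sum m p u' f.
Proof.
move=> L0 fLp [uLp _ uf] mu' e0 eM u'e uu'e.
have [C C0 HC] := Lp_cnorm_le_atom_bound L0.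
have p0 : 0 < p by have := p1; lra.
have pV0 : 0 <= p^-1 by rewrite invr_ge0 ltW.
have lam0 : 0 < lam by case/andP: (rg_lam rg).
have lam1 : lam < 1 by case/andP: (rg_lam rg).
pose t := lam `^ s.
have t0 : 0 < t by exact: powR_gt0.
have t1 : t < 1 by rewrite /t -[ltRHS](powR1r s) gt0_ltr_powR// nnegrE// ltW.
have sum0 k : 0 <= \sum_(Q <- cells Pg k) e k Q `^ p by apply: sumr_ge0 => Q _; exact: powR_ge0.
have M0 : 0 <= M := le_trans (sum0 0%N) (eM 0%N).
pose D := C * M `^ p^-1.
have D0 : 0 <= D by rewrite mulr_ge0 ?powR_ge0.
have norm_le k F : cmeasurable F -> {ae m, forall x, cmod (F x) <= atom_bound L (e k) k x} ->
    (Lp_cnorm m p F <= (D * t ^+ k)%:E)%E.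
  move=> mF Fe; apply: (le_trans (HC k (e k) F (e0 k) mF Fe)).
  rewrite lee_fin /D -!mulrA ler_wpM2l// mulrC ler_wpM2r ?exprn_ge0 ?(ltW t0)//.
  exact: le_powR.
have msum (v : nat -> T -> R[i]) n : (forall k, cmeasurable (v k)) ->
    cmeasurable (fun x => \sum_(i < n) v i x).
  move=> mv; rewrite (_ : (fun x => _) = (fun x => \sum_(i <- iota 0 n) v i x)).
    by apply: cmeasurable_sum => i _.
  by apply/funext => x; rewrite -(big_mkord xpredT (fun i => v i x)) /index_iota subn0.
have mf := LpC_cmeasurable fLp.
have mu k := LpC_cmeasurable (uLp k).
split.
- move=> k; have [? ?] := mu' k; split=> //.
  by apply: (le_lt_trans (norm_le k _ (mu' k) (u'e k))); exact: ltry.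
- apply: (@le_lt_trans _ _ (\sum_(0 <= k <oo) (D * t ^+ k)%:E)%E).
    apply: lee_nneseries => [k _ _|k _]; first exact: Lnorm_ge0.
    exact: (norm_le k _ (mu' k) (u'e k)).
  apply: (@nneseries_lty _ _ (D / (1 - t))) => [k|n].
    by rewrite mulr_ge0// exprn_ge0// ltW.
  rewrite -mulr_sumr ler_wpM2l// -[leRHS]mul1r ler_pdivlMr; last lra.
  by rewrite mulrC -opprB mulNr -subrX1 opprB gerBl exprn_ge0// ltW.
- pose dist (v : nat -> T -> R[i]) n := Lp_cnorm m p (fun x => f x - \sum_(k < n) v k x).
  suff : dist u' n.+1 @[n --> \oo] --> 0%E by rewrite (cvg_shiftS (dist u')).
  have shift : dist u n.+1 @[n --> \oo] --> 0%E by rewrite (cvg_shiftS (dist u)).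
  apply: (@squeeze_cvge _ _ _ _ (cst 0%E) _ (fun n => dist u n.+1 + (D * t ^+ n)%:E)%E).
  + apply: nearW => n; rewrite Lnorm_ge0 /=.
    have mA : measurable_fun [set: T] (fun x => cmod (f x - \sum_(k < n.+1) u k x)).
      by apply/cmeasurable_cmod/cmeasurableB => //; exact: msum.
    have mAB : measurable_fun [set: T] (fun x => cmod (f x - \sum_(k < n.+1) u' k x)).
      by apply/cmeasurable_cmod/cmeasurableB => //; exact: msum.
    have mBc : cmeasurable (fun x => \sum_(k < n.+1) u k x - \sum_(k < n.+1) u' k x).
      by apply: cmeasurableB; exact: msum.
    have mB := cmeasurable_cmod mBc.
    have mink := minkowski_EFin m mA mB p1.
    apply: (le_trans _ (le_trans mink _)).
      apply: le_Lnorm => //; first exact: measurable_funD.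
      move=> x; rewrite cmod_ge0 /=; apply: le_trans (cmodD _ _).
      by rewrite addrA subrK.
    by rewrite leeD2l//; exact: (norm_le n _ mBc (uu'e n)).
  + exact: cvg_cst.
  + rewrite -[X in _ --> X]adde0; apply: cvgeD => //.
    apply: cvg_EFin; first exact: nearW.
    rewrite (_ : fine \o _ = geometric D t).
      by apply: cvg_geometric; rewrite ger0_norm// ltW.
    by apply/funext => n.
Qed.

End LpTransfer.

(** * From block series to grid series *)

Section UniqueCell.
Context {d : measure_display} {T : measurableType d} {R : realType}.
Context {m : {measure set T -> \bar R}} {beta : T -> T -> R} {K lam : R}.
Context {z : nat -> set T -> T} {Pg : nat -> set (set T)}.
Hypothesis rg : regular_grid m beta K lam z Pg.
Implicit Types (k j : nat) (P Q : set T) (x y : T).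

(** The cells of a level form a partition only up to null sets; at these points a sum over a level
    reduces to one cell and telescoping is exact. *)
Definition unique_cells x := forall k, (exists2 Q, Pg k Q & Q x) /\
  forall Q Q', Pg k Q -> Pg k Q' -> Q x -> Q' x -> Q = Q'.

Lemma ae_forall_seq (J : eqType) (r : seq J) (P : J -> T -> Prop) :
  (forall i, i \in r -> {ae m, forall x, P i x}) ->
  {ae m, forall x, forall i, i \in r -> P i x}.
Proof.
elim: r => [|i r IHr] rP; first by apply: filterS filterT => x _ i; rewrite in_nil.
have Pi : {ae m, forall x, P i x} by apply: rP; rewrite inE eqxx.
have {}IHr := IHr (fun l lr => rP l (mem_behead (s := i :: r) lr)).
by apply: filterS2 Pi IHr => x Pix Prx l; rewrite inE => /orP[/eqP->|/Prx].
Qed.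

Lemma ae_unique_cells : {ae m, forall x, unique_cells x}.
Proof.
apply: ae_foralln => k.
have [m0 mQQ'] := rg_part rg k.
apply: filterI.
  exists (~` \bigcup_(Q in Pg k) Q); split=> //.
    apply: measurableC; apply: fin_bigcup_measurable; first exact: (rg_fin rg).
    by move=> Q /(rg_meas rg).
have : {ae m, forall x, forall Q, Q \in cells Pg k -> forall Q', Q' \in cells Pg k ->
    Q x -> Q' x -> Q = Q'}.
  apply: ae_forall_seq => Q /(mem_cells rg) kQ; apply: ae_forall_seq => Q' /(mem_cells rg) kQ'.
  have [->|/eqP QQ'] := eqVneq Q Q'; first by apply: filterS filterT.
  exists (Q `&` Q'); split; first by apply: measurableI; [exact: (rg_meas rg kQ)|exact: (rg_meas rg kQ')].
    exact: mQQ'.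
  by move=> x /= /not_implyP[Qx /not_implyP[]].
move=> aeH; apply: filterS aeH => x H Q Q' /(mem_cells rg) kQ /(mem_cells rg) kQ'.
exact: H.
Qed.

Lemma sum_anc_vol k j P : (k <= j)%N -> Pg k P ->
  \sum_(Q <- cells Pg j | anc Pg k Q == P) vol m Q <= vol m P.
Proof.
move=> kj kP; apply: (ae_disjoint_vol_sum (rg_mT rg)).
- exact: cells_uniq.
- by move=> Q /(mem_cells rg) /(rg_meas rg).
- by move=> A B /(mem_cells rg) kA /(mem_cells rg) kB; case: (rg_part rg j) => _; apply.
- by move=> Q /(mem_cells rg) jQ /eqP <-; exact: (anc_sub rg kj jQ).
- exact: (rg_meas rg kP).
Qed.

Lemma unique_cell_sum k P x (F : set T -> R[i]) : unique_cells x -> Pg k P -> P x ->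
  \sum_(Q <- cells Pg k) F Q * \1_Q x = F P.
Proof.
move=> ux kP Px; have [_ uniqx] := ux k.
rewrite (bigD1_seq P) /=; [|exact/(mem_cells rg)|exact: cells_uniq].
rewrite indicE mem_set// mulr1 big_seq_cond big1 ?addr0// => Q /andP[/(mem_cells rg) kQ QP].
rewrite indicE memNset ?mulr0// => Qx.
by move/eqP: QP; apply; exact: uniqx.
Qed.

Lemma le_atom_bound p s (L : R) (e F : set T -> R) k x : K <= L ->
  (forall Q, 0 <= e Q) ->
  (forall Q, Pg k Q -> Q x -> F Q <= e Q * vol m Q `^ (s - p^-1)) ->
  \sum_(Q <- cells Pg k) F Q * \1_Q x <=
    atom_bound (m := m) (beta := beta) (lam := lam) (z := z) (Pg := Pg) p s L e k x.
Proof.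
move=> KL e0 Fe; rewrite /atom_bound [leRHS]big_mkcond /= big_seq [leRHS]big_seq.
apply: ler_sum => Q /(mem_cells rg) kQ; rewrite indicE.
have [/set_mem Qx|] := boolP (x \in Q).
  rewrite mulr1 ifT ?Fe//; apply/asboolP.
  apply: (le_trans (rg_diam rg kQ Qx (rg_z rg kQ))).
  by rewrite ler_wpM2r// ltW// (rg_lamX rg).
by rewrite mulr0; case: ifP => // _; rewrite mulr_ge0 ?powR_ge0.
Qed.

End UniqueCell.

Section BlocksToGrid.
Context {d : measure_display} {T : measurableType d} {R : realType}.
Context {m : {measure set T -> \bar R}} {beta : T -> T -> R} {K lam : R}.
Context {z : nat -> set T -> T} {Pg : nat -> set (set T)}.
Hypothesis rg : regular_grid m beta K lam z Pg.
Variables (p s gamma : R) (q : \bar R).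
Hypotheses (p1 : 1 <= p) (s0 : 0 < s) (sp : s < p^-1) (sg : s < gamma) (q1 : (1 <= q)%E).
Implicit Types (k j : nat) (P Q : set T) (x y : T).
Local Notation nsum := (near_sum (beta := beta) (lam := lam) (z := z) (Pg := Pg)).
Variables (c : nat -> set T -> R[i]) (a : nat -> set T -> T -> R[i]) (L0 : R).
Hypotheses (L00 : 0 <= L0)
  (a_supp : forall k Q x, Pg k Q -> a k Q x <> 0 -> beta x (z k Q) <= L0 * lam ^+ k)
  (a_bound : forall k Q x, Pg k Q -> cmod (a k Q x) <= vol m Q `^ (s - p^-1))
  (a_holder : forall k Q x y, Pg k Q ->
     cmod (a k Q x - a k Q y) <= vol m Q `^ (s - p^-1 - gamma) * beta x y `^ gamma).

Let u k x := \sum_(Q <- cells Pg k) c k Q * a k Q x.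
Let v k Q := cmod (c k Q) * vol m Q `^ (s - p^-1).
(** Large enough that a block of level k not vanishing at a point x of [Q], or at some y with beta x
    y <= K lam^k, belongs to a cell close to [Q]. *)
Let L := K * (K + L0) + L0.
Let lg := lam `^ gamma.

Let K0 : 0 < K. Proof. exact: (rg_K0 rg). Qed.
Let lam0 : 0 < lam. Proof. by case/andP: (rg_lam rg). Qed.
Let g0 : 0 < gamma. Proof. exact: lt_trans s0 sg. Qed.
Let L0L : L0 <= L.
Proof. by rewrite /L lerDr mulr_ge0//; have := K0; have := L00; lra. Qed.
Let v0 k Q : 0 <= v k Q. Proof. by rewrite mulr_ge0 ?cmod_ge0 ?powR_ge0. Qed.
Let lg0 : 0 < lg. Proof. exact: powR_gt0. Qed.

Lemma block_sum_bound k j Q x : Pg j Q -> Q x -> cmod (u k x) <= nsum L v k Q.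
Proof.
move=> jQ Qx; apply: (le_trans (cmod_sum _ _ _)).
rewrite /near_sum [leRHS]big_mkcond /= big_seq [leRHS]big_seq.
apply: ler_sum => P /(mem_cells rg) kP; rewrite cmodM.
case: asboolP => [_|nclose]; first by rewrite ler_wpM2l ?cmod_ge0// a_bound.
suff -> : a k P x = 0 by rewrite cmod0 mulr0.
apply: contra_notP nclose => /(a_supp kP) xP; exists x => //.
by apply: (le_trans xP); rewrite ler_wpM2r// ltW// (rg_lamX rg).
Qed.

(** Hoelder continuity gives |P|^(-gamma) times the gamma-th power of beta x y, which is (lam^i /
    lam^k)^gamma up to K^(2 gamma). Only the distance of [y] to [x] is constrained, because [y] will
    also be the centre of the parent of [Q]. *)
Lemma block_sum_oscillation k i j Q x y : (k <= i)%N -> Pg j Q -> Q x ->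
  beta x y <= K * lam ^+ i ->
  cmod (u k x - u k y) <= K `^ gamma * K `^ gamma * lg ^+ (i - k) * nsum L v k Q.
Proof.
move=> ki jQ Qx xy; have lk0 := rg_lamX rg k; have li0 := rg_lamX rg i.
have C0 : 0 <= K `^ gamma * K `^ gamma * lg ^+ (i - k).
  by rewrite !mulr_ge0 ?powR_ge0 ?exprn_ge0// ltW.
rewrite -sumrB; apply: (le_trans (cmod_sum _ _ _)).
rewrite /near_sum mulr_sumr [leRHS]big_mkcond /= big_seq [leRHS]big_seq.
apply: ler_sum => P /(mem_cells rg) kP; rewrite -mulrBr cmodM.
case: asboolP => [_|nclose].
  rewrite mulrCA ler_wpM2l ?cmod_ge0//; apply: (le_trans (a_holder _ _ kP)).
  have vP := cell_vol_gt0 rg kP.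
  rewrite powRD; last by rewrite lt0r_neq0// implybT.
  rewrite -mulrA mulrC ler_wpM2r ?powR_ge0//.
  apply: (@le_trans _ _ (K `^ gamma * (lam ^+ k) `^ (- gamma) * (K * lam ^+ i) `^ gamma)).
    apply: ler_pM; rewrite ?powR_ge0//.
      by apply: (cell_vol_powRN_le rg) => //; exact: ltW.
    by apply: le_powR => //; [exact: ltW|exact: (rg_ge0 rg)].
  rewrite powRM ?(ltW K0) ?(ltW li0)// powRN !(powR_exprn rg) -/lg.
  have -> : lg ^+ i = lg ^+ (i - k) * lg ^+ k by rewrite -exprD subnK.
  have lgk : lg ^+ k != 0 by rewrite expf_neq0// lt0r_neq0.
  by rewrite le_eqVlt; apply/orP; left; apply/eqP; field.
suff [-> ->] : a k P x = 0 /\ a k P y = 0 by rewrite subr0 cmod0 mulr0.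
have K1 := rg_K rg.
split; apply: contra_notP nclose => /(a_supp kP) xP; exists x => //.
  by apply: (le_trans xP); rewrite ler_wpM2r// ltW.
apply: (le_trans (rg_tri rg x y _)).
apply: (@le_trans _ _ (K * (K * lam ^+ k + L0 * lam ^+ k))); last first.
  by rewrite /L -mulrDl mulrA ler_wpM2r ?(ltW lk0)// lerDl.
rewrite ler_wpM2l ?(ltW K0)// lerD//; apply: (le_trans xy).
by rewrite ler_wpM2l ?(ltW K0)//; exact: (rg_lam_le rg ki).
Qed.

(** The first summand pays for comparing a cell with its parent, where one factor [lg] is lost; the
    second covers the sampling error inside a cell and, by its 1, the top term k = j. *)
Let kap := K `^ gamma * K `^ gamma * lg^-1 + (K `^ gamma * K `^ gamma + 1).
Let w k j (_ : set T) : R := kap * lg ^+ (j - k).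
Let sprd := spread (beta := beta) (lam := lam) (z := z) (Pg := Pg) L w v.
Let e j Q := sprd j Q * vol m Q `^ (p^-1 - s).
Let G j Q := \sum_(k < j.+1) u k (z j Q).
(** Increments over the parent: along the ancestors of a cell of level j they add up to the sampled
    value [G j]. *)
Let D j Q := G j Q - (if j is i.+1 then G i (anc Pg i Q) else 0).

Let kap1 : 1 <= kap.
Proof.
have lgV : 0 < lg^-1 by rewrite invr_gt0.
by rewrite /kap; have := powR_ge0 K gamma; set A := K `^ gamma => A0; nra.
Qed.

Let w0 k j Q : 0 <= w k j Q.
Proof. by rewrite mulr_ge0 ?exprn_ge0 ?(ltW lg0)//; have := kap1; lra. Qed.

Let sprd0 j Q : 0 <= sprd j Q.
Proof. by apply: spread_ge0 => //; exact: v0. Qed.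

Let near0 k Q : 0 <= nsum L v k Q.
Proof. by apply: near_sum_ge0 => ? ?; exact: v0. Qed.

Let sampling_error j Q x : Pg j Q -> Q x ->
  cmod (\sum_(k < j.+1) u k x - G j Q) <= sprd j Q.
Proof.
move=> jQ Qx; rewrite /G -sumrB; apply: (le_trans (cmod_sum _ _ _)).
apply: ler_sum => -[k] /=; rewrite ltnS => kj _.
apply: (le_trans (block_sum_oscillation kj jQ Qx (rg_diam rg jQ Qx (rg_z rg jQ)))).
rewrite ler_wpM2r// /w ler_wpM2r ?exprn_ge0 ?(ltW lg0)// /kap.
have lgV : 0 < lg^-1 by rewrite invr_gt0.
by have := powR_ge0 K gamma; set A := K `^ gamma => A0; nra.
Qed.

Let coef_bound j Q : Pg j Q -> cmod (D j Q) <= sprd j Q.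
Proof.
move=> jQ; have zQ := rg_z rg jQ; rewrite /D /sprd /spread.
have top : cmod (u j (z j Q)) <= w j j Q *
    nsum L v j Q.
  apply: (le_trans (block_sum_bound j jQ zQ)).
  by rewrite /w subnn expr0 mulr1 ler_peMl.
case: j jQ zQ top => [|i] jQ zQ top; first by rewrite subr0 /G !big_ord_recr !big_ord0 /= !add0r.
rewrite /G big_ord_recr [in leRHS]big_ord_recr /= addrAC -sumrB.
apply: (le_trans (cmodD _ _)); apply: lerD; last exact: top.
apply: (le_trans (cmod_sum _ _ _)); apply: ler_sum => -[k] /=; rewrite ltnS => ki _.
have iP := anc_in rg (leqnSn i) jQ.
have zP := anc_sub rg (leqnSn i) jQ zQ.
apply: (le_trans (block_sum_oscillation ki jQ zQ (rg_diam rg iP zP (rg_z rg iP)))).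
rewrite ler_wpM2r// /w subSn// exprS mulrA ler_wpM2r ?exprn_ge0 ?(ltW lg0)// /kap.
rewrite mulrDl mulfVK ?lt0r_neq0// lerDl mulr_ge0 ?(ltW lg0)//.
by rewrite addr_ge0// mulr_ge0 ?powR_ge0.
Qed.

Let p0 : 0 < p. Proof. by have := p1; lra. Qed.

Let weight_sum k j P : (k <= j)%N -> Pg k P ->
  \sum_(Q <- cells Pg j | anc Pg k Q == P) vol m Q * w k j Q `^ p
    <= kap `^ p * (lg `^ p) ^+ (j - k) * vol m P.
Proof.
move=> kj kP; rewrite /w -mulr_suml mulrC.
have kap0 : 0 <= kap by have := kap1; lra.
have -> : (kap * lg ^+ (j - k)) `^ p = kap `^ p * (lg `^ p) ^+ (j - k).
  by rewrite powRM ?exprn_ge0 ?(ltW lg0)// powR_exprC// ltW.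
by rewrite ler_wpM2l ?mulr_ge0 ?powR_ge0 ?exprn_ge0 ?powR_ge0//; exact: (sum_anc_vol rg kj kP).
Qed.

Let c' j Q : R[i] := D j Q * (vol m Q `^ (p^-1 - s))%:C%C.

Let c'_atom j Q x : Pg j Q -> c' j Q * grid_atom m s p Q x = D j Q * \1_Q x.
Proof.
move=> jQ; rewrite /c' /grid_atom -!mulrA; congr (_ * _); rewrite mulrA -rmorphM /=.
rewrite -powRD; last by rewrite (lt0r_neq0 (cell_vol_gt0 rg jQ)) implybT.
by rewrite addrA subrK subrr powRr0 mul1r.
Qed.

Lemma block_series_grid_besov f : LpC m p f -> Lp_abs_sum m p u f ->
  (lqlp_norm p q Pg c < +oo)%E -> grid_besov m s p q Pg f.
Proof.
move=> fLp uf cfin; split=> //; exists c'.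
(* The product is lam^((gamma - s) p), below 1 because s < gamma. *)
have tau1 : lg `^ p * lam `^ (- (s * p)) < 1.
  rewrite /lg -powRrM -powRD; last by rewrite lt0r_neq0// implybT.
  rewrite -mulNr -mulrDl -[ltRHS](powR1r ((gamma - s) * p)) gt0_ltr_powR// ?nnegrE ?(ltW lam0)//.
    by rewrite mulr_gt0 ?subr_gt0.
  by case/andP: (rg_lam rg).
have L0' : 0 <= L by apply: le_trans L0L.
have sp' : 0 < s < p^-1 by rewrite s0.
have [C [t [C0 t01 HC]]] := spread_coef_estimate rg p1 L0' (powR_ge0 kap p)
  (powR_gt0 p lg0) sp' tau1 w0 weight_sum.
have e0 j Q : 0 <= e j Q by rewrite mulr_ge0 ?powR_ge0.
have eE j Q : Pg j Q -> e j Q * vol m Q `^ (s - p^-1) = sprd j Q.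
  move=> jQ; rewrite /e -mulrA -powRD; last by rewrite (lt0r_neq0 (cell_vol_gt0 rg jQ)) implybT.
  by rewrite addrA subrK subrr powRr0 mulr1.
have sum_e j : \sum_(Q <- cells Pg j) e j Q `^ p <=
    C * \sum_(k < j.+1) t ^+ (j - k) * \sum_(Q \in Pg k) cmod (c k Q) `^ p.
  have -> : \sum_(k < j.+1) t ^+ (j - k) * \sum_(Q \in Pg k) cmod (c k Q) `^ p =
      \sum_(k < j.+1) t ^+ (j - k) * \sum_(Q <- cells Pg k) cmod (c k Q) `^ p.
    by apply: eq_bigr => k _; rewrite (fsum_cells rg).
  by apply: (HC (fun k Q => cmod (c k Q))) => k Q; exact: cmod_ge0.
have sum_c' j : \sum_(Q \in Pg j) cmod (c' j Q) `^ p <= \sum_(Q <- cells Pg j) e j Q `^ p.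
  rewrite (fsum_cells rg) big_seq [leRHS]big_seq; apply: ler_sum => Q /(mem_cells rg) jQ.
  apply: le_powR; rewrite ?cmod_ge0 ?(ltW p0)// cmodM cmod_real ger0_norm ?powR_ge0//.
  by rewrite ler_wpM2r ?powR_ge0// coef_bound.
split; last first.
  by apply: (lqlp_norm_transfer p0 q1 t01 C0 _ cfin) => j; exact: le_trans (sum_c' j) (sum_e j).
have [M M0 HM] := lqlp_norm_bounded p0 q1 cfin.
have /andP[t0 t1] := t01.
have eM j : \sum_(Q <- cells Pg j) e j Q `^ p <= C * (M / (1 - t)).
  apply: (le_trans (sum_e j)); rewrite ler_wpM2l//.
  by apply: (geometric_convolution_le (a := fun k => \sum_(Q \in Pg k) cmod (c k Q) `^ p)) => // k;
     rewrite HM lqlp_sum_ge0.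
have u'E j x : \sum_(Q \in Pg j) c' j Q * grid_atom m s p Q x =
    \sum_(Q <- cells Pg j) D j Q * \1_Q x.
  by rewrite (fsum_cells rg); apply: eq_big_seq => Q /(mem_cells rg) jQ; exact: c'_atom.
rewrite (_ : (fun k x => _) = (fun j x => \sum_(Q <- cells Pg j) D j Q * \1_Q x)); last first.
  by apply/funext => j; apply/funext => x; exact: u'E.
have KL : K <= L by rewrite /L; have := rg_K rg; have := L00; nra.
apply: (Lp_abs_sum_transfer rg p1 s0 sp L0' fLp uf _ e0 eM).
- move=> j; apply: cmeasurable_sum => Q /(mem_cells rg) jQ.
  apply: cmeasurableM; first exact: cmeasurable_cst.
  rewrite (_ : \1_Q = (fun x => (\1_Q x : R)%:C%C)).
    by apply: cmeasurable_real; apply: measurable_indic; exact: (rg_meas rg jQ).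
  by apply/funext => x; rewrite !indicE; case: (x \in Q).
- move=> j; apply: filterS filterT => x _.
  apply: (@le_trans _ _ (\sum_(Q <- cells Pg j) cmod (D j Q) * \1_Q x)).
    apply: (le_trans (cmod_sum _ _ _)); apply: ler_sum => Q _.
    by rewrite cmodM !indicE; case: (x \in Q); rewrite ?cmod0// -[1]/(1%:C%C) cmod_real normr1.
  by apply: (le_atom_bound rg KL (e0 j)) => Q jQ Qx; rewrite eE// coef_bound.
- move=> j; apply: filterS (ae_unique_cells rg) => x ux.
  have [[Q jQ Qx] _] := ux j.
  (* At such a point only the ancestors of [Q] contribute, one for each level. *)
  have telescope i : (i <= j)%N ->
      \sum_(l < i.+1) \sum_(P <- cells Pg l) D l P * \1_P x = G i (anc Pg i Q).
    elim: i => [|i IHi] ij.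
      rewrite big_ord_recr big_ord0 /= add0r.
      rewrite (unique_cell_sum rg (D 0) ux (anc_in rg ij jQ) (anc_sub rg ij jQ Qx)).
      by rewrite /D subr0.
    rewrite big_ord_recr /= IHi; last exact: ltnW.
    rewrite (unique_cell_sum rg (D i.+1) ux (anc_in rg ij jQ) (anc_sub rg ij jQ Qx)).
    by rewrite /D (anc_anc rg (leqnSn i) ij jQ) addrC subrK.
  rewrite telescope// (anc_id rg jQ).
  apply: (le_trans (sampling_error jQ Qx)).
  rewrite /atom_bound (big_rem Q) /=; last exact/(mem_cells rg).
  rewrite ifT; last first.
    apply/asboolP; apply: (le_trans (rg_diam rg jQ Qx (rg_z rg jQ))).
    by rewrite ler_wpM2r// ltW// (rg_lamX rg).
  by rewrite eE// lerDl sumr_ge0// => P _; rewrite mulr_ge0 ?powR_ge0.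
Qed.

End BlocksToGrid.

(** * From grid series to block series *)

Section PartitionOfUnity.
Context {d : measure_display} {T : measurableType d} {R : realType}.
Context {m : {measure set T -> \bar R}} {beta : T -> T -> R} {K lam : R}.
Context {z : nat -> set T -> T} {Pg : nat -> set (set T)}.
Hypothesis rg : regular_grid m beta K lam z Pg.
Variables (gamma C : R) (dg : T -> T -> R).
Hypotheses (g0 : 0 < gamma) (dg_metric : is_metric dg) (C1 : 1 <= C).
Hypothesis dgE : forall x y, C^-1 * dg x y <= beta x y `^ gamma <= C * dg x y.
Hypothesis ball_pos : forall x r, 0 < r -> (0 < m (qball beta x r))%E.
Implicit Types (k j : nat) (P Q : set T) (x y : T).

Let dg_ge0 x y : 0 <= dg x y. Proof. by case: dg_metric. Qed.
Let dg_sym x y : dg x y = dg y x. Proof. by case: dg_metric. Qed.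
Let dg_tri x y t : dg x t <= dg x y + dg y t. Proof. by case: dg_metric. Qed.
Let C0 : 0 < C. Proof. by have := C1; lra. Qed.

Let dg_le x y : dg x y <= C * beta x y `^ gamma.
Proof. by case/andP: (dgE x y) => + _; rewrite mulrC ler_pdivrMr// mulrC. Qed.

(** The triangle inequality of the metric [dg] makes these distances 1-Lipschitz for [dg], hence
    Hoelder of exponent gamma for [beta]. This is how admissibility produces Hoelder functions. *)
Let setd Q x := inf [set dg x y | y in Q].

Let setd_le Q x y : Q y -> setd Q x <= dg x y.
Proof. by move=> Qy; apply: ge_inf; [exists 0 => _ [? _ <-]|exists y]. Qed.

Let setd_lip Q x y : Q !=set0 -> setd Q x - setd Q y <= dg x y.
Proof.
move=> [t Qt]; rewrite lerBlDr -lerBlDl; apply: lb_le_inf; first by exists (dg y t), t.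
move=> _ [t' Qt' <-]; rewrite lerBlDl; apply: (le_trans (setd_le x Qt')).
exact: dg_tri.
Qed.

Variable delta : R.
Hypothesis delta0 : 0 < delta.

Let lg := lam `^ gamma.
Let lg0 : 0 < lg. Proof. by apply: powR_gt0; case/andP: (rg_lam rg). Qed.
(** Chosen so that C rad_k = (delta lam^k)^gamma, which turns dg x y < rad k into beta x y <= delta
    lam^k. *)
Let eps := delta `^ gamma / C.
Let rad k := eps * lg ^+ k.

Let eps0 : 0 < eps. Proof. by rewrite divr_gt0 ?powR_gt0. Qed.
Let rad0 k : 0 < rad k. Proof. by rewrite mulr_gt0 ?exprn_gt0. Qed.

Let psi k Q x := Num.max 0 (1 - setd Q x / rad k).
Let Psi k x := \sum_(Q <- cells Pg k) psi k Q x.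

Let psi_ge0 k Q x : 0 <= psi k Q x. Proof. by rewrite le_max lexx. Qed.

Let cell_n0 k Q : Pg k Q -> Q !=set0.
Proof. by move=> kQ; exists (z k Q); exact: (rg_z rg kQ). Qed.

Let psi_lip1 k Q x y : Pg k Q -> psi k Q x - psi k Q y <= dg x y / rad k.
Proof.
move=> kQ; have := setd_lip y x (cell_n0 kQ); rewrite dg_sym => h.
have {h} : setd Q y / rad k - setd Q x / rad k <= dg x y / rad k.
  by rewrite -mulrBl ler_pM2r ?invr_gt0.
have : 0 <= dg x y / rad k by rewrite divr_ge0 ?dg_ge0 ?(ltW (rad0 k)).
rewrite /psi; set A := _ / _; set B := _ / _; set D := _ / _ => D0 h.
have : 1 - B <= Num.max 0 (1 - B) by rewrite le_max lexx orbT.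
have : 0 <= Num.max 0 (1 - B) by rewrite le_max lexx.
by set M := Num.max 0 (1 - B) => M0 M1; rewrite lerBlDr ge_max; apply/andP; split; lra.
Qed.

Let H0 := C / eps.

Let psi_lip k Q x y : Pg k Q ->
  `|psi k Q x - psi k Q y| <= H0 * (lg ^+ k)^-1 * beta x y `^ gamma.
Proof.
move=> kQ; apply: (@le_trans _ _ (dg x y / rad k)); last first.
  rewrite /H0 ler_pdivrMr// (le_trans (dg_le x y))//.
  have lk : lg ^+ k != 0 by rewrite expf_neq0 ?lt0r_neq0.
  have e0 : eps != 0 by rewrite lt0r_neq0.
  rewrite le_eqVlt; apply/orP; left; apply/eqP; rewrite /rad; field.
  by apply/andP.
by rewrite ler_norml psi_lip1// lerNl opprB dg_sym psi_lip1.
Qed.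

Let psi_supp k Q x : Pg k Q -> psi k Q x != 0 -> exists2 y, Q y & beta x y <= delta * lam ^+ k.
Proof.
move=> kQ psi0; have lk := rg_lamX rg k.
have : setd Q x < rad k.
  rewrite ltNge; apply/negP => h; move/eqP: psi0; apply; rewrite /psi max_l//.
  by rewrite subr_le0 ler_pdivlMr ?mul1r.
move=> /inf_lt[|_ [y Qy <-] xy].
  by have [t Qt] := cell_n0 kQ; exists (dg x t), t.
exists y => //; case/andP: (dgE x y) => _ h.
have dk : 0 <= delta * lam ^+ k by rewrite mulr_ge0// ltW.
rewrite leNgt; apply/negP => /(gt0_ltr_powR g0); rewrite !nnegrE => /(_ dk (rg_ge0 rg _ _)).
rewrite ltNge => /negP; apply; apply: (le_trans h).
rewrite powRM ?(ltW delta0) ?(ltW lk)// (powR_exprn rg) -/lg.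
apply: (@le_trans _ _ (C * rad k)); first by rewrite ler_wpM2l ?(ltW C0)// ltW.
rewrite /rad /eps le_eqVlt; apply/orP; left; apply/eqP; field.
exact: lt0r_neq0.
Qed.

(** The cells may miss a null set, but every ball has positive measure, so each point is as near to
    a cell as desired and some [psi] is at least 1/2 there. *)
Let Psi_ge k x : 2^-1 <= Psi k x.
Proof.
(* This radius turns beta x y < r into dg x y <= rad k / 2. *)
pose r := (rad k / (2 * C)) `^ gamma^-1.
have C20 : 0 < 2 * C by rewrite mulr_gt0.
have r0 : 0 < r by rewrite powR_gt0// divr_gt0.
have [Q kQ [y Qy xy]] : exists2 Q, Pg k Q & exists2 y, Q y & beta x y < r.
  apply: contrapT => nQ.
  have : (m (qball beta x r) <= 0)%E.
    rewrite -(rg_part rg k).1; apply: le_measure; rewrite ?inE.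
    - exact: (rg_ball rg).
    - apply: measurableC; apply: fin_bigcup_measurable; first exact: (rg_fin rg).
      by move=> Q /(rg_meas rg).
    - by move=> y xy [Q kQ Qy]; apply: nQ; exists Q => //; exists y.
  by rewrite leNgt ball_pos.
have dxy : dg x y <= rad k / 2.
  apply: (le_trans (dg_le x y)).
  apply: (@le_trans _ _ (C * r `^ gamma)).
    by rewrite ler_wpM2l ?(ltW C0)// le_powR ?(ltW g0) ?(ltW xy)//; exact: (rg_ge0 rg).
  rewrite /r -powRrM mulVf ?lt0r_neq0// powRr1 ?divr_ge0 ?(ltW C20) ?(ltW (rad0 k))//.
  rewrite le_eqVlt; apply/orP; left; apply/eqP; field.
  exact: lt0r_neq0.
have h : 2^-1 <= psi k Q x.
  rewrite /psi le_max; apply/orP; right.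
  have : setd Q x / rad k <= 2^-1.
    by rewrite ler_pdivrMr// mulrC; apply: le_trans dxy; exact: setd_le.
  lra.
apply: (le_trans h); rewrite /Psi (big_rem Q) /=; last exact/(mem_cells rg).
by rewrite lerDl sumr_ge0.
Qed.

(** Dividing by [Psi] preserves the Hoelder bound, because [Psi] is at least 1/2 and at most 2N of
    the [psi] are nonzero at x or at y. *)
Lemma partition_of_unity : exists (phi : nat -> set T -> T -> R) (H : R), [/\ 0 <= H,
  forall k Q x, 0 <= phi k Q x,
  forall k x, \sum_(Q <- cells Pg k) phi k Q x = 1,
  forall k Q x, Pg k Q -> phi k Q x != 0 -> exists2 y, Q y & beta x y <= delta * lam ^+ k &
  forall k Q x y, Pg k Q ->
    `|phi k Q x - phi k Q y| <= H * (lg ^+ k)^-1 * beta x y `^ gamma].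
Proof.
have K0 := rg_K0 rg.
have LK : 0 <= K * (delta + K) by rewrite mulr_ge0 ?addr_ge0 ?ltW.
have [N HN] := count_near_cells rg LK.
have H00 : 0 <= H0 by rewrite divr_ge0 ?ltW.
have near k Q x : Pg k Q -> psi k Q x != 0 -> beta x (z k Q) <= K * (delta + K) * lam ^+ k.
  move=> kQ /(psi_supp kQ)[y Qy xy]; apply: (le_trans (rg_tri rg x y _)).
  rewrite -mulrA ler_wpM2l ?(ltW K0)// mulrDl lerD//.
  exact: (rg_diam rg kQ Qy (rg_z rg kQ)).
have Psi0 k x : 0 < Psi k x by have := Psi_ge k x; lra.
have Psi_lip k x y : `|Psi k x - Psi k y| <=
    (N + N)%:R * (H0 * (lg ^+ k)^-1 * beta x y `^ gamma).
  set B := H0 * _ * _.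
  have B0 : 0 <= B by rewrite mulr_ge0 ?powR_ge0// mulr_ge0// invr_ge0 exprn_ge0// ltW.
  pose near_ t Q := `[< beta t (z k Q) <= K * (delta + K) * lam ^+ k >].
  rewrite /Psi -sumrB; apply: (le_trans (ler_norm_sum _ _ _)).
  apply: (@le_trans _ _ (\sum_(Q <- cells Pg k | near_ x Q) B + \sum_(Q <- cells Pg k | near_ y Q) B)).
    rewrite [X in _ <= X + _]big_mkcond [X in _ <= _ + X]big_mkcond /= -big_split /=.
    rewrite big_seq [leRHS]big_seq; apply: ler_sum => Q /(mem_cells rg) kQ.
    have [px|px] := eqVneq (psi k Q x) 0; last first.
      rewrite ifT; last by apply/asboolP; exact: near kQ px.
      apply: (le_trans (psi_lip x y kQ)); rewrite lerDl; by case: ifP.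
    have [py|py] := eqVneq (psi k Q y) 0; last first.
      rewrite [X in _ <= _ + X]ifT; last by apply/asboolP; exact: near kQ py.
      apply: (le_trans (psi_lip x y kQ)); rewrite lerDr; by case: ifP.
    by rewrite px py subr0 normr0 addr_ge0//; case: ifP.
  rewrite !big_const_seq !iter_addr_0 natrD mulrDl lerD// -[leLHS]mulr_natl ler_wpM2r// ler_nat; exact: HN.
exists (fun k Q x => psi k Q x / Psi k x), (2 * H0 + 2 * ((N + N)%:R * H0)); split.
- by rewrite addr_ge0 // mulr_ge0// mulr_ge0.
- by move=> k Q x; rewrite divr_ge0// ltW.
- by move=> k x; rewrite -mulr_suml mulfV//; exact: (lt0r_neq0 (Psi0 k x)).
- move=> k Q x kQ; rewrite mulf_eq0 negb_or => /andP[h _]; exact: psi_supp kQ h.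
- move=> k Q x y kQ.
  set b := beta x y `^ gamma; set l := (lg ^+ k)^-1.
  have -> : psi k Q x / Psi k x - psi k Q y / Psi k y =
     (psi k Q x - psi k Q y) / Psi k x + (psi k Q y / Psi k y) * ((Psi k y - Psi k x) / Psi k x).
    by field; rewrite !lt0r_neq0.
  have inv2 : (Psi k x)^-1 <= 2.
    by rewrite -[leRHS]invrK lef_pV2 ?posrE ?invr_gt0//; exact: Psi_ge.
  have iP0 : 0 <= (Psi k x)^-1 by rewrite invr_ge0 ltW.
  have frac : psi k Q y / Psi k y <= 1.
    rewrite ler_pdivrMr// mul1r /Psi (big_rem Q) /=; last exact/(mem_cells rg).
    by rewrite lerDl sumr_ge0.
  apply: (le_trans (ler_normD _ _)).
  rewrite (_ : _ * l * b = 2 * (H0 * l * b) + 2 * ((N + N)%:R * (H0 * l * b))); last by ring.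
  apply: lerD.
    rewrite normrM (ger0_norm iP0) mulrC ler_pM//; exact: psi_lip.
  rewrite normrM ger0_norm ?divr_ge0 ?(ltW (Psi0 _ _))//.
  rewrite normrM (ger0_norm iP0) -[leRHS]mul1r; apply: ler_pM => //.
  - by rewrite divr_ge0// ltW.
  - by rewrite mulr_ge0.
  - by rewrite mulrC ler_pM// distrC; exact: Psi_lip.
Qed.

End PartitionOfUnity.

(** * Smoothing the step functions of a grid series *)

Section GridToBlocks.
Context {d : measure_display} {T : measurableType d} {R : realType}.
Context {m : {measure set T -> \bar R}} {beta : T -> T -> R} {K lam : R}.
Context {z : nat -> set T -> T} {Pg : nat -> set (set T)}.
Hypothesis rg : regular_grid m beta K lam z Pg.
Variables (p s gamma eta c3 c4 : R) (q : \bar R).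
Hypotheses (p1 : 1 <= p) (s0 : 0 < s) (sp : s < p^-1) (g0 : 0 < gamma) (q1 : (1 <= q)%E).
Hypotheses (speta : s * p < eta) (c30 : 0 < c3) (c40 : 0 < c4).
Implicit Types (k i j : nat) (P Q : set T) (x y : T).
Hypothesis layer_measurable : forall A (r : R),
  measurable [set x | (qdist beta x A <= r%:E)%E].
Hypothesis layer_mass : forall k Q, (1 <= k)%N -> Pg k Q -> forall t : R, 0 < t ->
  (m (Q `&` [set x | (qdist beta x (~` Q) <= (c3 * t * lam ^+ k)%:E)%E])
    <= (c4 * t `^ eta)%:E * m Q)%E.
Variables (delta : R) (phi : nat -> set T -> T -> R) (H : R).
Hypotheses (delta0 : 0 < delta) (H0 : 0 <= H).
Hypotheses (phi_ge0 : forall k Q x, 0 <= phi k Q x)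
  (phi_sum : forall k x, \sum_(Q <- cells Pg k) phi k Q x = 1)
  (phi_supp : forall k Q x, Pg k Q -> phi k Q x != 0 ->
     exists2 y, Q y & beta x y <= delta * lam ^+ k)
  (phi_holder : forall k Q x y, Pg k Q ->
     `|phi k Q x - phi k Q y| <= H * ((lam `^ gamma) ^+ k)^-1 * beta x y `^ gamma)
  (phi_measurable : forall k Q, Pg k Q -> measurable_fun [set: T] (phi k Q)).
Variable c : nat -> set T -> R[i].

Local Notation nsum := (near_sum (beta := beta) (lam := lam) (z := z) (Pg := Pg)).

Let K0 : 0 < K. Proof. exact: (rg_K0 rg). Qed.
Let lam0 : 0 < lam. Proof. by case/andP: (rg_lam rg). Qed.
Let lam1 : lam < 1. Proof. by case/andP: (rg_lam rg). Qed.
Let p0 : 0 < p. Proof. by have := p1; lra. Qed.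
Let eta0 : 0 < eta. Proof. by apply: le_lt_trans speta; rewrite mulr_ge0// ltW. Qed.

(** Two cells of levels i and i + 1 whose smoothing functions are both nonzero at one point contain
    points within delta' lam^i of each other. *)
Let delta' := K * (delta + delta).
Let L := K * (delta' + K) + K.
(** Bounds the distance between arbitrary points of two such cells in units of lam^(i+1), hence the
    division by [lam]. *)
Let B := K * (K + K * (delta' + K)) / lam.
Let le0 := lam `^ eta.

Let delta'0 : 0 < delta'. Proof. by rewrite mulr_gt0// addr_gt0. Qed.
Let B0 : 0 < B. Proof. by rewrite divr_gt0// mulr_gt0// addr_gt0// mulr_gt0// addr_gt0. Qed.
Let L0 : 0 <= L. Proof. by rewrite addr_ge0 ?(ltW K0)// mulr_ge0 ?addr_ge0 ?ltW. Qed.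
Let le00 : 0 < le0. Proof. exact: powR_gt0. Qed.
Let le01 : le0 < 1.
Proof. by rewrite /le0 -[ltRHS](powR1r eta) gt0_ltr_powR// ?nnegrE// ltW. Qed.

(** All points of [Q] are required to be near the complement, so that such cells lie inside the set
    of the boundary layer condition. If the complement of [P] is empty, [qdist] is +oo and no
    nonempty [Q] qualifies. *)
Let layer j P Q := forall x, Q x -> (qdist beta x (~` P) <= (B * lam ^+ j)%:E)%E.

Let C5 := c4 * (B / c3) `^ eta.

Let layer_sum k j P : (1 <= k)%N -> (k <= j)%N -> Pg k P ->
  \sum_(Q <- cells Pg j | `[< anc Pg k Q = P /\ layer j P Q >]) vol m Q
    <= C5 * le0 ^+ (j - k) * vol m P.
Proof.
move=> k1 kj kP.
(* With this t the layer of width c3 t lam^k has width exactly B lam^j. *)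
pose t := B / c3 * lam ^+ (j - k).
have t0 : 0 < t by apply: mulr_gt0; [exact: divr_gt0|exact: exprn_gt0].
pose S := P `&` [set x | (qdist beta x (~` P) <= (c3 * t * lam ^+ k)%:E)%E].
have tE : c3 * t * lam ^+ k = B * lam ^+ j.
  rewrite /t -{2}(subnK kj) exprD; field; exact: lt0r_neq0.
have mP := rg_meas rg kP.
have mS : measurable S by apply: measurableI => //; exact: layer_measurable.
apply: (@le_trans _ _ (vol m S)).
  apply: (ae_disjoint_vol_sum (rg_mT rg)) => //.
  - exact: cells_uniq.
  - by move=> Q /(mem_cells rg) /(rg_meas rg).
  - by move=> A A' /(mem_cells rg) jA /(mem_cells rg) jA'; case: (rg_part rg j) => _; apply.
  - move=> Q /(mem_cells rg) jQ /asboolP[QP Ql] x Qx; split; first by rewrite -QP; exact: (anc_sub rg kj jQ Qx).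
    by rewrite /= tE; exact: (Ql x Qx).
rewrite -lee_fin volK//; last exact: (rg_mT rg).
apply: (le_trans (layer_mass k1 kP t0)).
rewrite -(volK (rg_mT rg) mP) -EFinM lee_fin ler_wpM2r ?vol_ge0// /C5 /t.
have Bc : 0 <= B / c3 by apply: divr_ge0; exact: ltW.
by rewrite powRM ?(ltW (rg_lamX rg _))// mulrA (powR_exprn rg).
Qed.

(* The cells of the levels [k] and [k.+1] all count as bad for level [k], so the top
   terms need no cancellation. *)
Let bad k j Q := (j <= k.+1)%N \/ layer j (anc Pg k Q) Q.
Let w k j Q : R := (`[< bad k j Q >])%:R.

Let w0 k j Q : 0 <= w k j Q. Proof. exact: ler0n. Qed.

(** The 1 covers the levels k and k + 1, where every cell counts. The division by [le0] compensates
    the loss of one level, there and in the passage from level 0 to level 1. *)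
Let Kw := (C5 + 1) / le0.

Let C50 : 0 < C5. Proof. by rewrite mulr_gt0// powR_gt0// divr_gt0. Qed.
Let Kw0 : 0 < Kw. Proof. by rewrite divr_gt0// addr_gt0. Qed.

Let weight_sum k j P : (k <= j)%N -> Pg k P ->
  \sum_(Q <- cells Pg j | anc Pg k Q == P) vol m Q * w k j Q `^ p
    <= Kw * le0 ^+ (j - k) * vol m P.
Proof.
move=> kj kP.
have wp Q : w k j Q `^ p = w k j Q.
  by rewrite /w; case: asboolP => _; rewrite ?powR1r// powR0// lt0r_neq0.
have vP := vol_ge0 m P.
have [jk|kj1] := leqP j k.+1.
  apply: (@le_trans _ _ (\sum_(Q <- cells Pg j | anc Pg k Q == P) vol m Q)).
    apply: ler_sum => Q _; rewrite wp -[leRHS]mulr1 ler_wpM2l ?vol_ge0//.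
    by rewrite /w; case: asboolP.
  apply: (le_trans (sum_anc_vol rg kj kP)); rewrite ler_peMl// /Kw.
  have : le0 <= le0 ^+ (j - k).
    by rewrite -[leLHS]expr1 ler_wiXn2l ?(ltW le00) ?(ltW le01)// leq_subLR addn1.
  rewrite mulrAC ler_pdivlMr// mul1r => h; have := C50; have := exprn_ge0 (j - k) (ltW le00); nra.
have -> : \sum_(Q <- cells Pg j | anc Pg k Q == P) vol m Q * w k j Q `^ p =
    \sum_(Q <- cells Pg j | `[< anc Pg k Q = P /\ layer j P Q >]) vol m Q.
  rewrite big_mkcond [RHS]big_mkcond; apply: eq_bigr => Q _; rewrite wp /w.
  case: eqP => [QP|QP]; last by rewrite ifF//; apply/negbTE/asboolPn => -[].
  have -> : `[< bad k j Q >] = `[< anc Pg k Q = P /\ layer j P Q >].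
    apply: asbool_equiv_eq; rewrite /bad QP leqNgt kj1; split; first by case.
    by move=> [_ ?]; right.
  by case: asboolP; rewrite ?mulr1 ?mulr0.
have C5Kw : C5 <= Kw * le0 by rewrite /Kw divfK ?lt0r_neq0// lerDl.
have C5Kw' : C5 <= Kw.
  by apply: (le_trans C5Kw); rewrite ler_piMr// ltW.
(* Level 0 has no boundary layer condition, but a cell close to the boundary of its
   level-0 ancestor is close to the boundary of its level-1 ancestor. *)
case: k kj kP kj1 {wp} => [|k] kj kP kj1; last first.
  apply: (le_trans (layer_sum (ltn0Sn k) kj kP)).
  by rewrite ler_wpM2r// ler_wpM2r// exprn_ge0// ltW.
have j1 : (1 <= j)%N by exact: ltnW.
apply: (@le_trans _ _ (\sum_(P' <- cells Pg 1 | anc Pg 0 P' == P)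
   \sum_(Q <- cells Pg j | `[< anc Pg 1 Q = P' /\ layer j P' Q >]) vol m Q)).
  have -> : \sum_(P' <- cells Pg 1 | anc Pg 0 P' == P)
      \sum_(Q <- cells Pg j | `[< anc Pg 1 Q = P' /\ layer j P' Q >]) vol m Q =
      \sum_(Q <- cells Pg j) \sum_(P' <- cells Pg 1 | anc Pg 0 P' == P)
        (if `[< anc Pg 1 Q = P' /\ layer j P' Q >] then vol m Q else 0).
    by rewrite [RHS]exchange_big; apply: eq_bigr => P' _; rewrite big_mkcond.
  rewrite big_mkcond /= big_seq [leRHS]big_seq; apply: ler_sum => Q /(mem_cells rg) jQ.
  have sum0 (r : seq (set T)) (E F : pred (set T)) :
      0 <= \sum_(P' <- r | E P') (if F P' then vol m Q else 0).
    by apply: sumr_ge0 => P' _; case: ifP => // _; exact: vol_ge0.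
  case: asboolP => [[QP Ql]|_]; last exact: sum0.
  rewrite (big_rem (anc Pg 1 Q)) /=; last exact/(mem_cells rg)/(anc_in rg j1 jQ).
  rewrite (anc_anc rg (ltnW (ltnSn 0)) j1 jQ) QP eqxx ifT ?lerDl//.
  apply/asboolP; split=> // x Qx; apply: le_trans (Ql x Qx).
  rewrite -QP -(anc_anc rg (leq0n 1) j1 jQ).
  apply: ereal_inf_le_tmp; apply: image_subset; apply: subsetC.
  exact: (anc_sub rg (leq0n 1) (anc_in rg j1 jQ)).
apply: (@le_trans _ _ (\sum_(P' <- cells Pg 1 | anc Pg 0 P' == P) C5 * le0 ^+ (j - 1) * vol m P')).
  rewrite big_seq_cond [leRHS]big_seq_cond; apply: ler_sum => P' /andP[/(mem_cells rg) kP' _].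
  exact: (layer_sum (leqnn 1) j1 kP').
rewrite -mulr_sumr; apply: ler_pM.
- by apply: mulr_ge0; [exact: ltW|apply: exprn_ge0; exact: ltW].
- by apply: sumr_ge0 => Q _; exact: vol_ge0.
- apply: (@le_trans _ _ (Kw * le0 * le0 ^+ (j - 1))).
    by rewrite ler_wpM2r// exprn_ge0// ltW.
  by rewrite -mulrA -exprS subn0 subn1 prednK.
- exact: (sum_anc_vol rg (leq0n 1) kP).
Qed.

Let v k P := cmod (c k P) * vol m P `^ (s - p^-1).
Let val k P : R[i] := c k P * (vol m P `^ (s - p^-1))%:C%C.
Let sprd := spread (beta := beta) (lam := lam) (z := z) (Pg := Pg) L w v.
(* [G 0] is 0 because level-0 cells have no diameter bound and so cannot carry
   blocks: the level-0 terms enter at level 1. *)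
Let G j Q : R[i] := if j is 0 then 0 else \sum_(k < j.+1) val k (anc Pg k Q).

Let v0 k Q : 0 <= v k Q. Proof. by apply: mulr_ge0; [exact: cmod_ge0|exact: powR_ge0]. Qed.
Let near0 k Q : 0 <= nsum L v k Q.
Proof. by apply: near_sum_ge0 => ? ?; exact: v0. Qed.
Let sprd0 j Q : 0 <= sprd j Q.
Proof. by apply: spread_ge0 => [? ? ?|? ?]; [exact: w0|exact: v0]. Qed.
Let cmod_val k P : cmod (val k P) = v k P.
Proof. by rewrite cmodM cmod_real ger0_norm ?powR_ge0. Qed.

Let near_sum_ge k Q P : Pg k P -> close (beta := beta) (lam := lam) (z := z) L k Q P ->
  v k P <= nsum L v k Q.
Proof.
move=> kP QP; rewrite /near_sum (big_rem P) /=; last exact/(mem_cells rg).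
by rewrite ifT ?lerDl ?sumr_ge0//; apply/asboolP.
Qed.

Let near_sum_ge2 k Q P P' : Pg k P -> Pg k P' -> P <> P' ->
  close (beta := beta) (lam := lam) (z := z) L k Q P ->
  close (beta := beta) (lam := lam) (z := z) L k Q P' ->
  v k P + v k P' <= nsum L v k Q.
Proof.
move=> kP kP' PP' QP QP'; rewrite /near_sum (big_rem P) /=; last exact/(mem_cells rg).
rewrite ifT; last exact/asboolP.
rewrite lerD2l (big_rem P') /=.
  by rewrite ifT ?lerDl ?sumr_ge0//; apply/asboolP.
by rewrite mem_rem_uniq ?cells_uniq// !inE; apply/andP; split; [apply/eqP => /esym|exact/(mem_cells rg)].
Qed.

Let KL : K <= L.
Proof. by rewrite lerDr mulr_ge0 ?(ltW K0)// addr_ge0 ?(ltW K0)// ltW. Qed.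

Let close_anc k j Q y : (k <= j)%N -> Pg j Q -> Q y ->
  close (beta := beta) (lam := lam) (z := z) L k Q (anc Pg k Q).
Proof.
move=> kj jQ Qy; exists y => //; have kP := anc_in rg kj jQ.
apply: (le_trans (rg_diam rg kP (anc_sub rg kj jQ Qy) (rg_z rg kP))).
by rewrite ler_wpM2r ?(ltW (rg_lamX rg k))//; exact: KL.
Qed.

(** If the level-k ancestors differ, [Q] has a point outside that of [Q'], and all points of [Q']
    are near it: [Q'] is in the boundary layer and its weight is 1. The two ancestors are then
    distinct cells close to [Q'], so the near sum contains both values. The case j = i + 1 serves
    the coefficients, j = i the approximation of partial sums. *)
Let term_diff i j k Q' Q y y' : (i <= j)%N -> (j <= i.+1)%N -> (k <= i)%N ->
  Pg j Q' -> Pg i Q -> Q' y -> Q y' -> beta y y' <= delta' * lam ^+ i ->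
  cmod (val k (anc Pg k Q') - val k (anc Pg k Q)) <= w k j Q' * nsum L v k Q'.
Proof.
move=> ij ji ki jQ' iQ Q'y Qy' yy'.
have li := rg_lamX rg i; have lk := rg_lamX rg k; have lj := rg_lamX rg j.
have kj := leq_trans ki ij.
have [->|/eqP PP'] := eqVneq (anc Pg k Q') (anc Pg k Q).
  by rewrite subrr cmod0 mulr_ge0.
have kP' := anc_in rg kj jQ'; have kP := anc_in rg ki iQ.
have -> : w k j Q' = 1.
  rewrite /w (_ : `[< _ >] = true)//; apply/asboolP; right => x Q'x.
  have [t Qt nt] : exists2 t, Q t & ~ anc Pg k Q' t.
    apply: contrapT => nQ; apply: PP'; apply/esym/(anc_uniq rg iQ kP') => t Qt.
    by apply: contrapT => nt; apply: nQ; exists t.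
  apply: (@le_trans _ _ (beta x t)%:E); first by apply: ereal_inf_lbound; exists t.
  rewrite lee_fin; apply: (@le_trans _ _ (K * (K + K * (delta' + K)) * lam ^+ i)).
    rewrite -mulrA; apply: (le_trans (rg_tri rg x y t)); rewrite ler_wpM2l ?(ltW K0)// mulrDl lerD//.
      apply: (le_trans (rg_diam rg jQ' Q'x Q'y)); rewrite ler_wpM2l ?(ltW K0)//.
      exact: (rg_lam_le rg ij).
    rewrite -mulrA; apply: (le_trans (rg_tri rg y y' t)); rewrite ler_wpM2l ?(ltW K0)// mulrDl lerD//.
    exact: (rg_diam rg iQ Qy' Qt).
  rewrite /B -!mulrA ler_wpM2l ?(ltW K0)// ler_wpM2l//.
    by rewrite addr_ge0 ?(ltW K0)// mulr_ge0 ?(ltW K0)// addr_ge0 ?(ltW K0)// ltW.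
  rewrite mulrC ler_pdivlMr// -exprSr; exact: (rg_lam_le rg ji).
rewrite mul1r; apply: (le_trans (cmodB _ _)); rewrite !cmod_val.
apply: near_sum_ge2 => //; first exact: (close_anc kj jQ' Q'y).
exists y => //; apply: (le_trans (rg_tri rg y y' _)).
apply: (@le_trans _ _ (K * (delta' + K) * lam ^+ k)); last first.
  by rewrite ler_wpM2r ?(ltW lk)// /L lerDl ltW.
rewrite -mulrA ler_wpM2l ?(ltW K0)// mulrDl lerD//.
  apply: (le_trans yy'); rewrite ler_wpM2l ?(ltW delta'0)//; exact: (rg_lam_le rg ki).
exact: (rg_diam rg kP (anc_sub rg ki iQ Qy') (rg_z rg kP)).
Qed.

Let term_top k j Q y : (k <= j)%N -> (j <= k.+1)%N -> Pg j Q -> Q y ->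
  cmod (val k (anc Pg k Q)) <= w k j Q * nsum L v k Q.
Proof.
move=> kj jk jQ Qy; rewrite (_ : w k j Q = 1); last first.
  by rewrite /w (_ : `[< _ >] = true)//; apply/asboolP; left.
rewrite mul1r cmod_val; apply: near_sum_ge; first exact: (anc_in rg kj jQ).
exact: (close_anc kj jQ Qy).
Qed.

Let coef_bound i Q' Q y y' : Pg i.+1 Q' -> Pg i Q -> Q' y -> Q y' ->
  beta y y' <= delta' * lam ^+ i -> cmod (G i.+1 Q' - G i Q) <= sprd i.+1 Q'.
Proof.
move=> iQ' iQ Q'y Qy' yy'.
case: i iQ' iQ yy' => [|i] iQ' iQ yy'.
  rewrite subr0 /G /sprd /spread; apply: (le_trans (cmod_sum _ _ _)).
  apply: ler_sum => -[k] /=; rewrite ltnS => k1 _.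
  exact: (term_top k1 _ iQ' Q'y).
rewrite /G /sprd /spread big_ord_recr [in leRHS]big_ord_recr /= addrAC -sumrB.
apply: (le_trans (cmodD _ _)); apply: lerD; last exact: (term_top (leqnn _) _ iQ' Q'y).
apply: (le_trans (cmod_sum _ _ _)); apply: ler_sum => -[k] /=; rewrite ltnS => ki _.
exact: (term_diff (leqnSn _) (leqnn _) ki iQ' iQ Q'y Qy').
Qed.

Let approx_bound j Q' Q y y' : Pg j Q' -> Pg j Q -> Q' y -> Q y' ->
  beta y y' <= delta' * lam ^+ j ->
  cmod (\sum_(k < j.+1) val k (anc Pg k Q') - G j Q) <= sprd j Q'.
Proof.
move=> jQ' jQ Q'y Qy' yy'.
case: j jQ' jQ yy' => [|j] jQ' jQ yy'.
  rewrite subr0 /sprd /spread; apply: (le_trans (cmod_sum _ _ _)).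
  apply: ler_sum => -[k] /=; rewrite ltnS => k1 _.
  exact: (term_top k1 _ jQ' Q'y).
rewrite /G /sprd /spread -sumrB; apply: (le_trans (cmod_sum _ _ _)).
apply: ler_sum => -[k] /=; rewrite ltnS => kj _.
exact: (term_diff (leqnn _) (leqnSn _) kj jQ' jQ Q'y Qy').
Qed.

Let phi_le1 k Q x : Pg k Q -> phi k Q x <= 1.
Proof.
move=> kQ; rewrite -(phi_sum k x) (big_rem Q) /=; last exact/(mem_cells rg).
by rewrite lerDl sumr_ge0.
Qed.

Let phi_near k Q x : Pg k Q -> phi k Q x != 0 -> beta x (z k Q) <= K * (delta + K) * lam ^+ k.
Proof.
move=> kQ /(phi_supp kQ)[y Qy xy]; apply: (le_trans (rg_tri rg x y _)).
rewrite -mulrA ler_wpM2l ?(ltW K0)// mulrDl lerD//.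
exact: (rg_diam rg kQ Qy (rg_z rg kQ)).
Qed.

Let h j x : R[i] := \sum_(Q <- cells Pg j) G j Q * (phi j Q x)%:C%C.
(** Since both partitions sum to 1, inserting each into the other level writes the increment of [h]
    through differences of [G] over nearby cells only; the factor [phi i.+1 Q'] localises the piece
    at [Q']. *)
Let block i Q' x : R[i] := \sum_(Q <- cells Pg i) (G i.+1 Q' - G i Q) * (phi i Q x * phi i.+1 Q' x)%:C%C.

Let coef_bound_at i Q' Q x : Pg i.+1 Q' -> Pg i Q -> phi i Q x * phi i.+1 Q' x != 0 ->
  cmod (G i.+1 Q' - G i Q) <= sprd i.+1 Q'.
Proof.
move=> iQ' iQ; rewrite mulf_eq0 negb_or => /andP[/(phi_supp iQ)[y' Qy' xy'] /(phi_supp iQ')[y Q'y xy]].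
apply: (coef_bound iQ' iQ Q'y Qy'); apply: (le_trans (rg_tri rg y x y')).
rewrite /delta' -mulrA ler_wpM2l ?(ltW K0)// mulrDl lerD// (rg_sym rg) (le_trans xy)//.
by rewrite ler_wpM2l ?(ltW delta0)//; exact: (rg_lam_le rg (leqnSn i)).
Qed.

Let block_sum i x : \sum_(Q' <- cells Pg i.+1) block i Q' x = h i.+1 x - h i x.
Proof.
have sumC k : \sum_(Q <- cells Pg k) (phi k Q x)%:C%C = 1 :> R[i].
  by rewrite -rmorph_sum /= phi_sum.
rewrite /block /h exchange_big /=.
under eq_bigr => Q _ do under eq_bigr => Q' _ do rewrite rmorphM /= mulrBl.
under eq_bigr => Q _ do rewrite sumrB.
rewrite sumrB; congr (_ - _).
  rewrite exchange_big /=; apply: eq_bigr => Q' _.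
  by rewrite -mulr_sumr -mulr_suml sumC mul1r.
by apply: eq_bigr => Q _; rewrite -!mulr_sumr sumC mulr1.
Qed.

Let block_bound i Q' x : Pg i.+1 Q' -> cmod (block i Q' x) <= sprd i.+1 Q' * phi i.+1 Q' x.
Proof.
move=> iQ'; apply: (le_trans (cmod_sum _ _ _)).
have -> : sprd i.+1 Q' * phi i.+1 Q' x =
    \sum_(Q <- cells Pg i) sprd i.+1 Q' * (phi i Q x * phi i.+1 Q' x).
  by rewrite -mulr_sumr -mulr_suml phi_sum mul1r.
rewrite big_seq [leRHS]big_seq; apply: ler_sum => Q /(mem_cells rg) iQ.
rewrite cmodM cmod_real ger0_norm ?mulr_ge0//.
have [->|nz] := eqVneq (phi i Q x * phi i.+1 Q' x) 0; first by rewrite !mulr0.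
by rewrite ler_wpM2r ?mulr_ge0// (coef_bound_at iQ' iQ nz).
Qed.

Let LK : 0 <= K * (delta + K).
Proof. by rewrite mulr_ge0 ?(ltW K0)// addr_ge0 ?(ltW K0)// ltW. Qed.

(** Only the Q whose product with the function of [Q'] is nonzero at x or at y matter, at most 2N of
    them, and for these the jump of [G] is bounded by the spread. *)
Let block_holder : exists2 Hb, 0 <= Hb & forall i Q' x y, Pg i.+1 Q' ->
  cmod (block i Q' x - block i Q' y) <=
    sprd i.+1 Q' * (Hb * ((lam `^ gamma) ^+ i.+1)^-1 * beta x y `^ gamma).
Proof.
have [N HN] := count_near_cells rg LK.
exists ((N + N)%:R * (H + H)) => [|i Q' x y iQ']; first by rewrite mulr_ge0// addr_ge0.
have lg0 n : 0 < (lam `^ gamma) ^+ n by rewrite exprn_gt0// powR_gt0.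
set b := beta x y `^ gamma; have b0 : 0 <= b by exact: powR_ge0.
set l := ((lam `^ gamma) ^+ i.+1)^-1.
have l0 : 0 <= l by rewrite invr_ge0 ltW.
have lgi : ((lam `^ gamma) ^+ i)^-1 <= l.
  rewrite /l lef_pV2 ?posrE// exprS ler_piMl ?(ltW (lg0 i))//.
  by rewrite -[leRHS](powR1r gamma) le_powR// ltW.
pose M := sprd i.+1 Q' * ((H + H) * l * b).
have M0 : 0 <= M by rewrite /M !mulr_ge0// addr_ge0.
pose nr t Q := `[< beta t (z i Q) <= K * (delta + K) * lam ^+ i >].
have prod_diff Q : Pg i Q -> `|phi i Q x * phi i.+1 Q' x - phi i Q y * phi i.+1 Q' y| <= (H + H) * l * b.
  move=> iQ.
  have -> : phi i Q x * phi i.+1 Q' x - phi i Q y * phi i.+1 Q' y =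
     (phi i Q x - phi i Q y) * phi i.+1 Q' x + phi i Q y * (phi i.+1 Q' x - phi i.+1 Q' y) by ring.
  apply: (le_trans (ler_normD _ _)); rewrite !normrM !mulrDl lerD//.
    rewrite -[leRHS]mulr1 ler_pM// ?(ger0_norm (phi_ge0 _ _ _)) ?phi_le1//.
    by apply: (le_trans (phi_holder x y iQ)); rewrite ler_wpM2r// ler_wpM2l.
  by rewrite -[leRHS]mul1r ler_pM// ?(ger0_norm (phi_ge0 _ _ _)) ?phi_le1//; exact: phi_holder.
have term Q : Pg i Q -> (phi i Q x * phi i.+1 Q' x != 0) || (phi i Q y * phi i.+1 Q' y != 0) ->
    cmod ((G i.+1 Q' - G i Q) *
      ((phi i Q x * phi i.+1 Q' x)%:C%C - (phi i Q y * phi i.+1 Q' y)%:C%C)) <= M.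
  move=> iQ nz; rewrite -rmorphB cmodM cmod_real /M ler_pM ?cmod_ge0 ?prod_diff//.
  by case/orP: nz => nz; exact: (coef_bound_at iQ' iQ nz).
rewrite /block -sumrB; apply: (le_trans (cmod_sum _ _ _)).
apply: (@le_trans _ _ (\sum_(Q <- cells Pg i | nr x Q) M + \sum_(Q <- cells Pg i | nr y Q) M)).
  rewrite [X in _ <= X + _]big_mkcond [X in _ <= _ + X]big_mkcond /= -big_split /=.
  rewrite big_seq [leRHS]big_seq; apply: ler_sum => Q /(mem_cells rg) iQ; rewrite -mulrBr.
  have [px|px] := eqVneq (phi i Q x * phi i.+1 Q' x) 0; last first.
    have nx : nr x Q.
      by apply/asboolP/(phi_near iQ); apply: contra_neq px => ->; rewrite mul0r.
    by rewrite ifT//; apply: (le_trans (term _ iQ _)); rewrite ?px// lerDl; case: ifP.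
  have [py|py] := eqVneq (phi i Q y * phi i.+1 Q' y) 0; last first.
    have ny : nr y Q.
      by apply/asboolP/(phi_near iQ); apply: contra_neq py => ->; rewrite mul0r.
    by rewrite [X in _ <= _ + X]ifT//; apply: (le_trans (term _ iQ _)); rewrite ?py ?orbT// lerDr; case: ifP.
  by rewrite px py subrr mulr0 cmod0 addr_ge0//; case: ifP.
rewrite !big_const_seq !iter_addr_0.
apply: (@le_trans _ _ (N%:R * M + N%:R * M)).
  by rewrite lerD// -[leLHS]mulr_natl ler_wpM2r// ler_nat; exact: HN.
by rewrite /M natrD le_eqVlt; apply/orP; left; apply/eqP; ring.
Qed.

Lemma grid_series_blocks f : LpC m p f ->
  Lp_abs_sum m p (fun k x => \sum_(Q \in Pg k) c k Q * grid_atom m s p Q x) f ->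
  (lqlp_norm p q Pg c < +oo)%E ->
  exists (c' : nat -> set T -> R[i]) (a : nat -> set T -> T -> R[i]),
  [/\ forall Q x, a 0 Q x = 0,
      forall k Q x, Pg k.+1 Q -> a k.+1 Q x <> 0 ->
        exists2 y, Q y & beta x y <= delta * lam ^+ k.+1,
      forall k Q x, Pg k Q -> cmod (a k Q x) <= vol m Q `^ (s - p^-1),
      forall k Q x y, Pg k Q -> cmod (a k Q x - a k Q y)
        <= vol m Q `^ (s - p^-1 - gamma) * beta x y `^ gamma &
      Lp_abs_sum m p (fun k x => \sum_(Q \in Pg k) c' k Q * a k Q x) f /\
      (lqlp_norm p q Pg c' < +oo)%E].
Proof.
move=> fLp uf cfin; have [Hb Hb0 HHb] := block_holder.
have volE Q j : Pg j Q -> vol m Q != 0 by move=> jQ; rewrite lt0r_neq0// (cell_vol_gt0 rg jQ).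
pose V := K * (K * K + 1).
(* The 1 serves the size bound and the other term the Hoelder bound: |Q| <= V lam^k turns
   lam^(-gamma k) into V^gamma |Q|^(-gamma). *)
pose Kc := 1 + Hb * V `^ gamma.
have Kc1 : 1 <= Kc by rewrite lerDl mulr_ge0 ?powR_ge0.
have Kc0 : 0 < Kc by apply: lt_le_trans Kc1.
pose W Q := vol m Q `^ (p^-1 - s).
have W0 j Q : Pg j Q -> 0 < W Q by move=> jQ; apply: powR_gt0; exact: (cell_vol_gt0 rg jQ).
have WV j Q : Pg j Q -> (W Q)^-1 = vol m Q `^ (s - p^-1) by move=> jQ; rewrite -powRN opprB.
pose e j Q := Kc * (sprd j Q * W Q).
have e0 j Q : 0 <= e j Q.
  by apply: mulr_ge0; [exact: ltW|apply: mulr_ge0; [exact: sprd0|exact: powR_ge0]].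
(* Only an inequality, because the inverse of [e] is 0 by convention when the spread vanishes. *)
have e_sprd j Q X : Pg j Q -> 0 <= X -> (e j Q)^-1 * (sprd j Q * X) <= Kc^-1 * (vol m Q `^ (s - p^-1) * X).
  move=> jQ X0; have [s_0|sN0] := eqVneq (sprd j Q) 0.
    rewrite s_0 mul0r mulr0; apply: mulr_ge0; first by rewrite invr_ge0 ltW.
    by rewrite mulr_ge0// powR_ge0.
  rewrite -(WV _ _ jQ) /e; have WN0 : W Q != 0 by rewrite lt0r_neq0// (W0 _ _ jQ).
  have KcN0 : Kc != 0 by rewrite lt0r_neq0.
  by rewrite le_eqVlt; apply/orP; left; apply/eqP; field; rewrite sN0 WN0 KcN0.
have inv_e j Q : 0 <= (e j Q)^-1 by rewrite invr_ge0.
pose c' j Q : R[i] := if j is 0 then 0 else (e j Q)%:C%C.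
pose a j Q x : R[i] := if j is i.+1 then ((e j Q)^-1)%:C%C * block i Q x else 0.
have c'a i Q x : Pg i.+1 Q -> c' i.+1 Q * a i.+1 Q x = block i Q x.
  move=> iQ; rewrite /c' /a mulrA -rmorphM /=.
  (* If [e] vanishes, so does the spread, and then the bound on the block makes it 0: the
     factorisation survives division by 0. *)
  have [e_0|eN0] := eqVneq (e i.+1 Q) 0; last by rewrite mulfV// mul1r.
  rewrite e_0 mul0r mul0r; have : sprd i.+1 Q = 0.
    move/eqP: e_0; rewrite /e mulf_eq0 (negbTE (lt0r_neq0 Kc0)) /= mulf_eq0.
    by rewrite (negbTE (lt0r_neq0 (W0 _ _ iQ))) orbF => /eqP.
  move=> s_0; have := block_bound x iQ; rewrite s_0 mul0r => b0.
  apply/esym/ComplexField.Normc.eq0_normc/eqP.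
  by rewrite eq_le [in X in X && _]b0 cmod_ge0.
have vol_s_ge0 Q : 0 <= vol m Q `^ (s - p^-1) by exact: powR_ge0.
have KcV1 : Kc^-1 <= 1 by rewrite invf_le1.
exists c', a; split.
- by [].
- move=> k Q x kQ; rewrite /a => aN0; apply: (phi_supp kQ); apply: contra_notN aN0 => /eqP px.
  rewrite /block big1 ?mulr0// => Q' _.
  by rewrite px mulr0 mulr0.
- move=> [|k] Q x kQ; first by rewrite /a cmod0.
  rewrite /a cmodM cmod_real ger0_norm//.
  apply: (@le_trans _ _ ((e k.+1 Q)^-1 * (sprd k.+1 Q * 1))).
    by rewrite ler_wpM2l// (le_trans (block_bound x kQ))// ler_wpM2l// phi_le1.
  apply: (le_trans (e_sprd _ _ 1 kQ ler01)).
  by rewrite mulr1 ler_piMl.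
- move=> [|k] Q x y kQ.
    by rewrite /a subr0 cmod0 mulr_ge0 ?powR_ge0.
  rewrite /a -mulrBr cmodM cmod_real ger0_norm//.
  set X := Hb * ((lam `^ gamma) ^+ k.+1)^-1 * beta x y `^ gamma.
  have lg0 : 0 < (lam `^ gamma) ^+ k.+1 by rewrite exprn_gt0// powR_gt0.
  have X0 : 0 <= X by rewrite !mulr_ge0 ?powR_ge0// invr_ge0 ltW.
  apply: (@le_trans _ _ ((e k.+1 Q)^-1 * (sprd k.+1 Q * X))).
    by rewrite ler_wpM2l// HHb.
  apply: (le_trans (e_sprd _ _ X kQ X0)).
  have vQ := cell_vol_gt0 rg kQ.
  have -> : vol m Q `^ (s - p^-1 - gamma) = vol m Q `^ (s - p^-1) * vol m Q `^ (- gamma).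
    by rewrite -powRD// (volE _ _ kQ) implybT.
  rewrite mulrCA -[leRHS]mulrA ler_wpM2l// /X !mulrA ler_wpM2r ?powR_ge0// -mulrA.
  rewrite mulrC ler_pdivrMr// powRN [leRHS]mulrC ler_pdivlMr ?powR_gt0//.
  apply: (@le_trans _ _ (Hb * V `^ gamma)); last by rewrite /Kc lerDr.
  rewrite -mulrA ler_wpM2l// mulrC ler_pdivrMr//.
  rewrite -(powR_exprn rg) -powRM ?(ltW (rg_lamX rg _))//; last first.
    by rewrite /V mulr_ge0 ?(ltW K0)// addr_ge0// mulr_ge0 ?(ltW K0).
  by rewrite le_powR ?(ltW g0) ?(ltW vQ)//; exact: (cell_vol_le rg kQ).
(* The product is lam^(eta - s p), below 1 because s p < eta. *)
- have tau1 : le0 * lam `^ (- (s * p)) < 1.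
    rewrite /le0 -powRD; last by rewrite lt0r_neq0// implybT.
    rewrite -[ltRHS](powR1r (eta - s * p)) gt0_ltr_powR// ?nnegrE ?(ltW lam0)//.
    by rewrite subr_gt0.
  have sp' : 0 < s < p^-1 by rewrite s0.
  have [C [t [C0 t01 HC]]] := spread_coef_estimate rg p1 L0 (ltW Kw0) le00 sp' tau1 w0 weight_sum.
  have /andP[t0 t1] := t01.
  have CK0 : 0 <= Kc `^ p * C by rewrite mulr_ge0 ?powR_ge0.
  have sum_e j : \sum_(Q <- cells Pg j) e j Q `^ p <=
      Kc `^ p * C * \sum_(k < j.+1) t ^+ (j - k) * \sum_(Q \in Pg k) cmod (c k Q) `^ p.
    have -> : \sum_(k < j.+1) t ^+ (j - k) * \sum_(Q \in Pg k) cmod (c k Q) `^ p =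
        \sum_(k < j.+1) t ^+ (j - k) * \sum_(Q <- cells Pg k) cmod (c k Q) `^ p.
      by apply: eq_bigr => k _; rewrite (fsum_cells rg).
    rewrite -mulrA; apply: (@le_trans _ _ (Kc `^ p * \sum_(Q <- cells Pg j) (sprd j Q * W Q) `^ p)).
      rewrite mulr_sumr; apply: ler_sum => Q _.
      have sW : 0 <= sprd j Q * W Q.
        by apply: mulr_ge0; [exact: sprd0|exact: powR_ge0].
      by rewrite /e (powRM p (ltW Kc0) sW).
    rewrite ler_wpM2l ?powR_ge0//.
    by apply: (HC (fun k Q => cmod (c k Q))) => k Q; exact: cmod_ge0.
  have sum_c' j : \sum_(Q \in Pg j) cmod (c' j Q) `^ p <= \sum_(Q <- cells Pg j) e j Q `^ p.
    rewrite (fsum_cells rg); apply: ler_sum => Q _.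
    apply: le_powR; rewrite ?cmod_ge0 ?(ltW p0)// /c'.
    by case: j => [|j]; rewrite ?cmod0// cmod_real ger0_norm.
  split; last first.
    by apply: (lqlp_norm_transfer p0 q1 t01 CK0 _ cfin) => j; exact: le_trans (sum_c' j) (sum_e j).
  have [M M0 HM] := lqlp_norm_bounded p0 q1 cfin.
  have eM j : \sum_(Q <- cells Pg j) e j Q `^ p <= Kc `^ p * C * (M / (1 - t)).
    apply: (le_trans (sum_e j)); rewrite ler_wpM2l//.
    by apply: (geometric_convolution_le (a := fun k => \sum_(Q \in Pg k) cmod (c k Q) `^ p)) => // k;
       rewrite HM lqlp_sum_ge0.
  pose u' j x : R[i] := if j is i.+1 then \sum_(Q <- cells Pg i.+1) block i Q x else 0.
  rewrite (_ : (fun k x => _) = u'); last first.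
    apply/funext => j; apply/funext => x; rewrite (fsum_cells rg) /u'.
    case: j => [|i]; first by rewrite big1// => Q _; rewrite /c' mul0r.
    by apply: eq_big_seq => Q /(mem_cells rg); exact: c'a.
  have sprd_e j Q : Pg j Q -> sprd j Q <= e j Q * vol m Q `^ (s - p^-1).
    move=> jQ; rewrite -(WV _ _ jQ) /e -mulrA mulfK ?lt0r_neq0 ?(W0 _ _ jQ)//.
    by rewrite ler_peMl//; exact: sprd0.
  (* Covers both the diameter of a cell and the support of a smoothing function. *)
  pose L' := L + K * (delta + K).
  have L'0 : 0 <= L' by rewrite addr_ge0.
  have KL' : K <= L' by rewrite (le_trans KL)// lerDl.
  have LKL' : K * (delta + K) <= L' by rewrite lerDr.
  have sumu' n x : \sum_(i < n.+1) u' i x = h n x.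
    elim: n => [|n IHn].
      rewrite big_ord_recr big_ord0 /= addr0 /h big1// => Q _.
      by rewrite mul0r.
    by rewrite big_ord_recr /= IHn block_sum addrC subrK.
  apply: (Lp_abs_sum_transfer rg p1 s0 sp L'0 fLp uf _ e0 eM).
  + move=> [|i]; first exact: cmeasurable_cst.
    apply: cmeasurable_sum => Q' /(mem_cells rg) iQ'.
    apply: cmeasurable_sum => Q /(mem_cells rg) iQ.
    apply: cmeasurableM; first exact: cmeasurable_cst.
    by apply: cmeasurable_real; apply: measurable_funM; exact: phi_measurable.
  + move=> j; apply: filterS filterT => x _.
    case: j => [|i]; rewrite /u'.
      by rewrite cmod0 sumr_ge0// => Q _; rewrite mulr_ge0 ?powR_ge0.
    apply: (le_trans (cmod_sum _ _ _)).
    rewrite /atom_bound [leRHS]big_mkcond /= big_seq [leRHS]big_seq.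
    apply: ler_sum => Q /(mem_cells rg) iQ; apply: (le_trans (block_bound x iQ)).
    case: asboolP => [_|far].
      apply: le_trans (sprd_e _ _ iQ); apply: ler_piMr; [exact: sprd0|exact: phi_le1].
    suff -> : phi i.+1 Q x = 0 by rewrite mulr0.
    apply/eqP; apply: contra_notT far => /(phi_near iQ) xz; apply: (le_trans xz).
    by rewrite ler_wpM2r// ltW// (rg_lamX rg).
  + move=> j; apply: filterS (ae_unique_cells rg) => x ux.
    have [[Q jQ Qx] _] := ux j.
    rewrite sumu'.
    have -> : \sum_(i < j.+1) \sum_(P \in Pg i) c i P * grid_atom m s p P x =
        \sum_(k < j.+1) val k (anc Pg k Q).
      apply: eq_bigr => -[k] /=; rewrite ltnS => kj _; rewrite (fsum_cells rg).
      rewrite -(unique_cell_sum rg (val k) ux (anc_in rg kj jQ) (anc_sub rg kj jQ Qx)).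
      by apply: eq_bigr => P _; rewrite /val /grid_atom mulrA.
    apply: (@le_trans _ _ (sprd j Q)).
      (* Multiplying the value on [Q] by the sum of all [phi j Q'] compares it with [G j Q'] only
         for cells near x. *)
      have sumC : \sum_(Q' <- cells Pg j) (phi j Q' x)%:C%C = 1 :> R[i].
        by rewrite -rmorph_sum /= phi_sum.
      rewrite -[X in cmod (X - _)]mulr1 -sumC mulr_sumr /h -sumrB.
      apply: (le_trans (cmod_sum _ _ _)).
      rewrite -[leRHS]mulr1 -(phi_sum j x) mulr_sumr big_seq [leRHS]big_seq.
      apply: ler_sum => Q' /(mem_cells rg) jQ'; rewrite -mulrBl cmodM cmod_real ger0_norm//.
      have [->|nz] := eqVneq (phi j Q' x) 0; first by rewrite !mulr0.
      rewrite ler_wpM2r//; have [y Q'y xy] := phi_supp jQ' nz.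
      apply: (approx_bound jQ jQ' Qx Q'y); apply: (le_trans xy).
      rewrite ler_wpM2r ?(ltW (rg_lamX rg _))// /delta'.
      have := rg_K rg; have := delta0; nra.
    apply: (le_trans (sprd_e _ _ jQ)).
    rewrite /atom_bound (big_rem Q) /=; last exact/(mem_cells rg).
    rewrite ifT; last first.
      apply/asboolP; apply: (le_trans (rg_diam rg jQ Qx (rg_z rg jQ))).
      by rewrite ler_wpM2r// ltW// (rg_lamX rg).
    by rewrite lerDl sumr_ge0// => P _; rewrite mulr_ge0 ?powR_ge0.
Qed.

End GridToBlocks.

(** * The homogeneous space *)

Section MaciasSegoviaGrid.
Context {R : realType} {X : ptopologicalType}.
Variables (m : {measure set (borelType X) -> \bar R}) (rho : X -> X -> R).
Variables (gamma Cb : R) (Pg : nat -> set (set X)) (z : nat -> set X -> X).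
Variables (eta c1 c2 c3 c4 lam : R).
Hypothesis rhoH : homogeneous_space m rho.
Hypothesis cX : compact [set: X].
Hypothesis mX : m [set: X] = 1%E.
Hypothesis m1 : forall x : X, m [set x] = 0%E.
Local Notation beta := (ms_beta m rho).
Hypothesis Cb1 : 1 <= Cb.
Hypothesis Cbtri : quasi_triangle Cb beta.
Hypothesis adm : admissible beta gamma.
Hypothesis gridP : good_grid m Pg.
Hypothesis adapted : grid_adapted m beta eta c1 c2 c3 c4 lam z Pg.

Let g0 : 0 < gamma. Proof. by case: adm. Qed.

Lemma ms_beta_refl x : beta x x = 0.
Proof.
case: adm => _ [_ d0 _ _] [C _ /(_ x x)/andP[_]].
rewrite (d0 x x).2// mulr0 => h.
have /eqP : beta x x `^ gamma = 0 by apply/eqP; rewrite eq_le h powR_ge0.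
by rewrite powR_eq0 => /andP[/eqP].
Qed.

(** The set where g exceeds a is a union of [beta]-balls by Hoelder continuity, and these balls are
    open. *)
Lemma holder_measurable (g : X -> R) (A : R) : 0 <= A ->
  (forall x y, `|g x - g y| <= A * beta x y `^ gamma) ->
  measurable_fun [set: borelType X] (g : borelType X -> R).
Proof.
move=> A0 gA; apply: (measurability (@RGenOInfty.G R)).
  exact: RGenOInfty.measurableE.
move=> _ [_ [a ->] <-]; rewrite setTI; apply: borel_open.
have -> : g @^-1` `]a, +oo[ = \bigcup_(B in [set B | exists x r,
   B = qball beta x r /\ qball beta x r `<=` [set y | a < g y]]) B.
  apply/seteqP; split=> x; rewrite /= in_itv /= andbT; last first.
    by move=> [_ [y [r [-> sub]]]] /sub.
  move=> ax; pose r := ((g x - a) / (A + 1)) `^ gamma^-1.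
  have A1 : 0 < A + 1 by lra.
  have gxa : 0 < g x - a by lra.
  exists (qball beta x r); last by rewrite /qball /= ms_beta_refl powR_gt0// divr_gt0.
  exists x, r; split=> // y; rewrite /qball /= => xy.
  have h1 : beta x y `^ gamma <= (g x - a) / (A + 1).
    apply: (@le_trans _ _ (r `^ gamma)).
      by rewrite le_powR ?(ltW g0) ?(ltW xy)//; exact: (ms_beta_ge0 rhoH cX).
    by rewrite /r -powRrM mulVf ?lt0r_neq0// powRr1// divr_ge0 ?ltW.
  have h2 : A * beta x y `^ gamma < g x - a.
    apply: (@le_lt_trans _ _ (A * ((g x - a) / (A + 1)))); first by rewrite ler_wpM2l.
    by rewrite mulrA ltr_pdivrMr//; nra.
  have := gA x y; have := ler_norm (g x - g y); lra.
by apply: bigcup_open => _ [x [r [-> _]]]; exact: (open_ms_ball rhoH cX).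
Qed.

(** Relaxing the bound to strict inequalities with 1/(n+1) to spare exhibits the layer as a
    countable intersection of unions of open balls. *)
Lemma ms_layer_measurable (A : set X) (r : R) :
  measurable ([set x | (qdist beta x A <= r%:E)%E] : set (borelType X)).
Proof.
have -> : [set x | (qdist beta x A <= r%:E)%E] =
    \bigcap_n \bigcup_(y in A) qball beta y (r + n.+1%:R^-1).
  apply/seteqP; split=> x /=.
    move=> xA n _.
    have : (qdist beta x A < (r + n.+1%:R^-1)%:E)%E.
      by apply: (le_lt_trans xA); rewrite lte_fin ltrDl invr_gt0.
    move=> /ereal_inf_lt[_ [y Ay <-]]; rewrite lte_fin => xy.
    by exists y => //; rewrite /qball /= ms_beta_sym.
  move=> H; apply/lee_addgt0Pr => e e0.
  have [n ne] : exists n : nat, n.+1%:R^-1 < e.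
    exists (Num.trunc e^-1); rewrite -[ltRHS]invrK ltf_pV2 ?posrE ?invr_gt0//.
    exact: truncnS_gt.
  have [y Ay xy] := H n I; apply: (@le_trans _ _ (beta x y)%:E).
    by apply: ereal_inf_lbound; exists y.
  rewrite -EFinD lee_fin ms_beta_sym; apply: (le_trans (ltW xy)).
  by rewrite lerD2l ltW.
apply: bigcapT_measurable => n; apply: borel_open; apply: bigcup_open => y _.
exact: (open_ms_ball rhoH cX).
Qed.

Lemma adapted_diam k Q x y : (1 <= k)%N -> Pg k Q -> Q x -> Q y -> beta x y <= c2 * lam ^+ k.
Proof.
move=> k1 kQ Qx Qy; case: adapted => _ _ _ /(_ k Q k1 kQ)[_ + _].
rewrite -lee_fin; apply: le_trans; apply: ereal_sup_ubound.
by exists x, y.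
Qed.

Lemma ms_ball_gt0 x r : 0 < r -> (0 < m (qball beta x r))%E.
Proof.
move=> r0; have [Kg Kg0 HKg] := vol_ms_ball_ge rhoH cX mX m1.
have mB := measurable_ms_ball rhoH cX x r.
rewrite -(volK mX mB) lte_fin.
have r'0 : 0 < Num.min 1 r by rewrite lt_min ltr01.
have r'1 : Num.min 1 r <= 1 by rewrite ge_min lexx.
have := HKg x _ r'0 r'1 => h.
have : 0 < vol m (qball beta x (Num.min 1 r)) by rewrite -(pmulr_rgt0 _ Kg0); exact: lt_le_trans h.
move=> /lt_le_trans; apply; apply: (le_vol mX) => //; first exact: measurable_ms_ball.
by move=> y; rewrite /qball /= => /lt_le_trans; apply; rewrite ge_min lexx orbT.
Qed.

Lemma ms_regular_grid : exists K, regular_grid m beta K lam z Pg.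
Proof.
case: (gridP) => Pfin Pmeas [Ppart Pnest] _ _.
case: (adapted) => -[eta0 c10 c20 c30 c40] /andP[lam0 lam1] Pz Pad.
have [Kv Kv0 HKv] := vol_ms_ball_le rhoH cX mX.
have [Kg Kg0 HKg] := vol_ms_ball_ge rhoH cX mX m1.
(* The lower volume bound is available for radii up to 1 only. *)
pose c1' := Num.min 1 c1.
have c1'0 : 0 < c1' by rewrite lt_min ltr01.
(* Adaptedness gives no inner ball at level 0; the volumes of its finitely many cells are bounded
   below through the sum of their inverses. *)
pose S := \sum_(Q <- cells Pg 0) (vol m Q)^-1.
have S0 : 0 <= S by apply: sumr_ge0 => Q _; rewrite invr_ge0 vol_ge0.
have Kc0 : 0 < Kg / c1' by rewrite divr_gt0.
have Cb0 : 0 < Cb by have := Cb1; lra.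
pose K := 1 + Cb + Kv + c2 + Kg / c1' + S.
have beta0 := ms_beta_ge0 rhoH cX.
exists K; split => //.
- by have := Cb1; rewrite /K; lra.
- by rewrite lam0.
- exact: ms_beta_refl.
- exact: ms_beta_sym.
- move=> x y t; apply: (le_trans (Cbtri x y t)); rewrite ler_wpM2r ?addr_ge0//.
  by rewrite /K; lra.
- exact: measurable_ms_ball.
- move=> x r r0; apply: (le_trans (HKv x r r0)); rewrite ler_wpM2r ?(ltW r0)//.
  by rewrite /K; lra.
- by move=> k Q /Pmeas[].
- by move=> k Q /Pmeas[].
- move=> [|k] Q x y kQ Qx Qy.
    rewrite expr0 mulr1; apply: (le_trans (ms_beta_le1 rhoH cX mX x y)).
    by rewrite /K; lra.
  apply: (le_trans (adapted_diam _ kQ Qx Qy)) => //.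
  by rewrite ler_wpM2r ?exprn_ge0 ?(ltW lam0)// /K; lra.
- move=> [|k] Q kQ.
    have [mQ Qpos] := Pmeas _ _ kQ.
    have vQ := vol_gt0 mX mQ Qpos.
    rewrite expr0 -ler_pdivrMr// div1r; apply: (@le_trans _ _ S).
      rewrite /S (big_rem Q) /=; last by rewrite /cells in_fset_set ?inE.
      by rewrite lerDl sumr_ge0// => P _; rewrite invr_ge0 vol_ge0.
    by rewrite /K; lra.
  have [mQ Qpos] := Pmeas _ _ kQ.
  have [sub _ _] := Pad k.+1 Q isT kQ.
  have lk0 : 0 < lam ^+ k.+1 by rewrite exprn_gt0.
  have lk1 : lam ^+ k.+1 <= 1 by rewrite exprn_ile1 ?ltW.
  have r0 : 0 < c1' * lam ^+ k.+1 by rewrite mulr_gt0.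
  have r1 : c1' * lam ^+ k.+1 <= 1.
    by rewrite mulr_ile1 ?(ltW c1'0) ?(ltW lk0)// ge_min lexx.
  have h := HKg (z k.+1 Q) _ r0 r1.
  have h2 : vol m (qball beta (z k.+1 Q) (c1' * lam ^+ k.+1)) <= vol m Q.
    apply: (le_vol mX) => //; first exact: measurable_ms_ball.
    apply: subset_trans sub => y; rewrite /qball /= => /lt_le_trans; apply.
    by rewrite ler_pM2r// ge_min lexx orbT.
  apply: (@le_trans _ _ (Kg / c1' * vol m Q)); last first.
    by rewrite ler_wpM2r ?vol_ge0// /K; lra.
  rewrite mulrAC ler_pdivlMr// mulrC; apply: (le_trans h).
  by rewrite ler_wpM2l// ltW.
Qed.

End MaciasSegoviaGrid.

(** * The two inclusions *)

Unset Implicit Arguments.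
Set Strict Implicit.

Theorem proposition2p5 (R : realType) (I : ptopologicalType)
    (m : {measure set (borelType I) -> \bar R}) (rho : I -> I -> R)
    (gamma Cb : R) (Pg : nat -> set (set I)) (z : nat -> set I -> I)
    (eta c1 c2 c3 c4 lam : R) (s p : R) (q : \bar R) :
  homogeneous_space m rho ->
  compact [set: I] ->
  m [set: I] = 1%E ->
  (forall x : I, m [set x] = 0%E) ->
  1 <= Cb -> quasi_triangle Cb (ms_beta m rho) ->
  admissible (ms_beta m rho) gamma ->
  good_grid m Pg ->
  grid_adapted m (ms_beta m rho) eta c1 c2 c3 c4 lam z Pg ->
  1 <= p -> (1 <= q)%E ->
  0 < s < p^-1 -> s * p < eta -> s < gamma ->
  hly_besov m (ms_beta m rho) Cb c2 lam gamma z Pg s p q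
  = grid_besov m s p q Pg.
Proof.
move=> rhoH cI mI m1 Cb1 Cbtri adm gridP adapted p1 q1 /andP[s0 sp] speta sg.
have [K rg] := ms_regular_grid rhoH cI mI m1 Cb1 Cbtri adm gridP adapted.
have [[eta0 c10 c20 c30 c40] /andP[lam0 lam1] Pz Pad] := adapted.
have [g0 dgM [C C1 dgE]] := adm.
have CbL : 0 < Cb by lra.
apply/seteqP; split=> f [fLp].
  move=> [c [a [blk uf cfin]]].
  have L0 : 0 <= 3 * Cb * c2 by rewrite !mulr_ge0// ltW.
  apply: (block_series_grid_besov rg p1 s0 sp sg q1 L0 (c := c) (a := a)) => //.
  - move=> k Q x kQ ax; have [supp _ _] := blk k Q kQ.
    by rewrite ms_beta_sym; apply/ltW/supp/subset_closure.
  - by move=> k Q x kQ; have [_ + _] := blk k Q kQ; apply.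
  - by move=> k Q x y kQ; have [_ _] := blk k Q kQ; apply.
  - rewrite (_ : (fun k x => _) = (fun k x => \sum_(Q \in Pg k) c k Q * a k Q x))//.
    by apply/funext => k; apply/funext => x; rewrite (fsum_cells rg).
move=> [c [uf cfin]].
(* Chosen so that Cb (2 delta) = c2: leaving the cell by delta lam^k and then passing to the closure
   by another delta lam^k costs at most c2 lam^k. *)
pose delta := c2 / (2 * Cb).
have delta0 : 0 < delta by rewrite divr_gt0// mulr_gt0.
have [phi [H [H0 phi0 phi1 phi_supp phi_hol]]] :=
  partition_of_unity rg g0 dgM C1 dgE (ms_ball_gt0 rhoH cI mI m1) delta0.
have phi_meas k Q : Pg k Q -> measurable_fun [set: borelType I] (phi k Q).
  move=> kQ; apply: (holder_measurable rhoH cI adm _ (fun x y => phi_hol k Q x y kQ)).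
  by rewrite mulr_ge0// invr_ge0 exprn_ge0// powR_ge0.
have layer k Q : (1 <= k)%N -> Pg k Q -> forall t : R, 0 < t ->
   (m (Q `&` [set x | (qdist (ms_beta m rho) x (~` Q) <= (c3 * t * lam ^+ k)%:E)%E])
    <= (c4 * t `^ eta)%:E * m Q)%E.
  by move=> k1 kQ; have [_ _] := Pad k Q k1 kQ.
have [c' [a [a0 a_supp a_bound a_hol [u'f c'fin]]]] :=
  grid_series_blocks rg p1 s0 sp g0 q1 speta c30 c40
    (ms_layer_measurable rhoH cI) layer delta0 H0 phi0 phi1 phi_supp phi_hol phi_meas
    fLp uf cfin.
split=> //; exists c', a; split=> // k Q kQ; split.
- case: k kQ => [|k] kQ.
    rewrite (_ : [set x | _] = set0) ?closure0//.
    by rewrite -subset0 => x /=; rewrite a0.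
  have lk : 0 < lam ^+ k.+1 by rewrite exprn_gt0.
  have dl : 0 < delta * lam ^+ k.+1 by rewrite mulr_gt0.
  move=> x xcl; rewrite /qball /=.
  have [x' [/= ax' xx']] : [set x | a k.+1 Q x <> 0] `&` qball (ms_beta m rho) x (delta * lam ^+ k.+1) !=set0.
    apply: xcl; apply: open_nbhs_nbhs; split; first exact: (open_ms_ball rhoH cI).
    by rewrite /qball /= (ms_beta_refl adm).
  have [y Qy x'y] := a_supp _ _ _ kQ ax'.
  have h1 : ms_beta m rho (z k.+1 Q) y <= c2 * lam ^+ k.+1.
    exact: (adapted_diam adapted (ltn0Sn k) kQ (Pz _ _ kQ) Qy).
  have h2 : ms_beta m rho y x <= Cb * (2 * (delta * lam ^+ k.+1)).
    apply: (le_trans (Cbtri y x' x)); rewrite ler_wpM2l ?(ltW CbL)// mulr2n mulrDl mul1r.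
    rewrite lerD//; first by rewrite ms_beta_sym.
    by rewrite ms_beta_sym ltW.
  have h3 : Cb * (2 * (delta * lam ^+ k.+1)) = c2 * lam ^+ k.+1.
    by rewrite /delta; field; exact: lt0r_neq0.
  (* Both [y] from the centre and [x] from [y] are within c2 lam^k, which gives 2 Cb c2 lam^k; the
     radius 3 Cb c2 lam^k is strictly larger. *)
  apply: (le_lt_trans (Cbtri _ y _)).
  apply: (@le_lt_trans _ _ (Cb * (2 * (c2 * lam ^+ k.+1)))).
    by rewrite ler_wpM2l ?(ltW CbL)//; lra.
  have : 0 < Cb * (c2 * lam ^+ k.+1) by rewrite !mulr_gt0.
  by rewrite -!mulrA; lra.
- by move=> x; exact: a_bound.
- by move=> x y; exact: a_hol.
Qed.
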